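(* Suppose $m,n\in\mathbb N$, $m\ge n$, are such that $\nu:=\nu_{m,n}=\beta(g(m)-g(n))\ge0$ is an isolated eigenvalue of the Araki Hamiltonian $\ln\Delta_0$, set $\ell:=m-n\in\mathbb N$, assume $\sum_{r=0}^\infty r^\ell e^{-\beta g(r)}<+\infty$, and let $f$ be a Schwartz function on $\mathbb R$ whose Fourier transform $\hat f\in C_0^\infty(\mathbb R)$ is supported by $[\nu-\varepsilon,\nu+\varepsilon]$ and is strictly positive on $(\nu-\varepsilon,\nu+\varepsilon)$, with $\hat f(\nu)=1$, for $$0<\varepsilon<{\rm dist}(\nu,sp(\ln\Delta_0)\setminus\{\nu\}).$$ Then, setting $k(t):=\beta(g(t+\ell)-g(t))$ and $p(t):=\hat f(k(t))$ for $t\in\mathbb R$, we have: i) $sp(k(N))\subset sp(\ln\Delta_0)$ and $\nu\in sp(k(N))$ is an isolated eigenvalue of $k(N)$ acting on $h$; ii) $p(N)$ is the spectral projection of $N$ corresponding to the Borel set $B:=\{n'\in\mathbb N:g(m)-g(n)=g(n'+\ell)-g(n')\}\subseteq sp(N)$, and $p(N-\ell\cdot I)$ is the spectral projection of $N$ corresponding to $B+\ell\subseteq\mathbb N$; iii) the densely defined, closed operator $(X,D(X))$ on $h$ given by $$D(X):=D(N^{\ell/2}),\qquad X:=p(N)\circ A^\ell$$ satisfies the relations $$XX^*=(N+1)\cdots(N+\ell\cdot I)p(N),$$ $$X^*X=N(N-I)\cdots(N-(\ell-1)\cdot I)p(N-\ell\cdot I),$$ $$[X,X^*]=(N+1)\cdots(N+\ell\cdot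 I)p(N)-N(N-I)\cdots(N-(\ell-1)\cdot I)p(N-\ell\cdot I);$$ iv) if $B$ is unbounded, $(X^*X,D(N^\ell))$ and $(XX^*,D(N^\ell))$ are unbounded with discrete spectra; v) if $B$ and $B+\ell$ differ by a finite set, then $([X,X^*],D(N^\ell))$ is infinitesimally small with respect to $(N^\ell,D(N^\ell))$; vi) $\xi:=X\xi_0\in L^2(h)$ is an eigenvector of $\ln\Delta_0$ with eigenvalue $\nu$: $(\ln\Delta_0)\xi=\nu\cdot\xi$.
   Context: $\mathbb N=\{0,1,2,\dots\}$, $h=l^2(\mathbb N)$ with natural basis $\{e_k\}$; $N$ is the Number Operator $Ne_k=ke_k$; $A$ is the annihilation operator and $A^*$ the creation operator on $D(A)=D(A^* )=D(\sqrt N)$: $Ae_0=0$, $Ae_k=\sqrt k\,e_{k-1}$ ($k\ge1$), $A^*e_k=\sqrt{k+1}\,e_{k+1}$. $g:\mathbb R\to\mathbb R$ is a function vanishing on $(-\infty,0]$ and strictly increasing on $[0,+\infty)$, $\beta>0$. $\rho_\beta:=e^{-\beta g(N)}/{\rm Tr}(e^{-\beta g(N)})$ and $\xi_0:=\rho_\beta^{1/2}\in L^2(h)$, where $L^2(h)$ is the space of Hilbert-Schmidt operators on $h$. $B(h)$ acts on $L^2(h)$ by left composition, $J\eta=\eta^*$, and unbounded operators on $h$ act on (suitable domains of) $L^2(h)$ by left composition, $j(X):=JXJ$. The modular operator $\Delta_0$ of the state ${\rm Tr}(\cdot\,\rho_\beta)$ satisfies $\Delta_0^{it}(\eta)=\rho_\beta^{it}\eta\rho_\beta^{-it}$,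 $\eta\in L^2(h)$; the Araki Hamiltonian is $\ln\Delta_0=-\beta\,\overline{g(N)-j(g(N))}$ and $sp(\ln\Delta_0)=\overline{\{\nu_{m,n}:m,n\in\mathbb N\}}$, $\nu_{m,n}:=\beta(g(m)-g(n))$. Fourier transform: $\hat f(s)=\int_{\mathbb R}f(t)e^{ist}dt$. $[X,X^*]:=XX^*-X^*X$. A self-adjoint operator has discrete spectrum if its spectrum consists only of isolated eigenvalues of finite degeneracy. $(A,D(A))$ is infinitesimally small w.r.t. $(B,D(B))$ if $D(B)\subseteq D(A)$ and the infimum of the $\varepsilon>0$ for which there is $b_\varepsilon\ge0$ with $\|A\eta\|^2\le\varepsilon\|B\eta\|^2+b_\varepsilon\|\eta\|^2$ for all $\eta\in D(B)$ is zero.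
   Formalization: ii) p(N-ℓI) is the B+ℓ projection if no j<ℓ has g(j)=g(m)-g(n), else only on [ℓ,∞); iii) X closed and last two relations verbatim if ℕ∖B is finite, else X closable, relations on D(X) or for its closure; iv) needs ℓ>0; discrete if ℕ∖B finite, else closures discrete off 0. *)

(* Defs.v *)
From HB Require Import structures.
From mathcomp Require Import all_boot all_order all_algebra.
From mathcomp Require Import all_classical all_reals all_analysis.
From mathcomp Require Import complex.
Set Implicit Arguments.
Unset Strict Implicit.
Unset Printing Implicit Defensive.
Import Order.TTheory GRing.Theory Num.Theory numFieldNormedType.Exports.
Local Open Scope classical_set_scope.
Local Open Scope ring_scope.
Local Open Scope complex_scope.

Notation normc := Normc.normc.

Definition sqsum (R : realType) (a : nat -> R) : \bar R :=
  (\sum_(0 <= k <oo) ((a k) ^+ 2)%:E)%E.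

Definition nrm2 (R : realType) (a : nat -> R) : R := Num.sqrt (fine (sqsum a)).

Section sqsum.
Variable R : realType.
Implicit Types (a b c : nat -> R).

Let sq_ge0 a : forall k, true -> (0 <= ((a k) ^+ 2)%:E)%E.
Proof. by move=> k _; rewrite lee_fin sqr_ge0. Qed.

Lemma sqsum_ge0 a : (0 <= sqsum a)%E.
Proof. by apply: nneseries_ge0 => k _ _; exact: sq_ge0. Qed.

Lemma nrm2_ge0 a : 0 <= nrm2 a.
Proof. exact: sqrtr_ge0. Qed.

Lemma sqsum_nrm2 a : (sqsum a < +oo)%E -> sqsum a = ((nrm2 a) ^+ 2)%:E.
Proof.
move=> afin; rewrite /nrm2 sqr_sqrtr ?fine_ge0 ?sqsum_ge0 // fineK //.
by rewrite ge0_fin_numE // sqsum_ge0.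
Qed.

Lemma sqsum_psum a n :
  (\sum_(0 <= k < n) ((a k) ^+ 2)%:E = ((Num.sqrt (\sum_(k < n) (a k) ^+ 2)) ^+ 2)%:E)%E.
Proof.
by rewrite sqr_sqrtr ?sumr_ge0 // => [|i _]; rewrite ?sqr_ge0 // sumEFin big_mkord.
Qed.

Lemma psum_le_nrm2 a n : (sqsum a < +oo)%E ->
  Num.sqrt (\sum_(k < n) (a k) ^+ 2) <= nrm2 a.
Proof.
move=> afin; rewrite -(@ler_pXn2r _ 2) ?nnegrE ?sqrtr_ge0 // -lee_fin.
rewrite -sqsum_nrm2 // -sqsum_psum.
by apply: nneseries_lim_ge => k _ _; exact: sq_ge0.
Qed.

Let minkowski2D (x y u v : R) :
  Num.sqrt ((x + u) ^+ 2 + (y + v) ^+ 2) <=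
  Num.sqrt (x ^+ 2 + y ^+ 2) + Num.sqrt (u ^+ 2 + v ^+ 2).
Proof.
exact: (le_normcD (x +i* y : Rcomplex R) (u +i* v)).
Qed.

Lemma psum_minkowski a b c n : (forall k, 0 <= c k <= a k + b k) ->
  Num.sqrt (\sum_(k < n) (c k) ^+ 2) <=
  Num.sqrt (\sum_(k < n) (a k) ^+ 2) + Num.sqrt (\sum_(k < n) (b k) ^+ 2).
Proof.
move=> cab; elim: n => [|n IHn]; first by rewrite !big_ord0 sqrtr0 addr0.
rewrite !big_ord_recr /=.
set A := \sum_(k < n) (a k) ^+ 2 in IHn *.
set B := \sum_(k < n) (b k) ^+ 2 in IHn *.
set G := \sum_(k < n) (c k) ^+ 2 in IHn *.
have A0 : 0 <= A by apply: sumr_ge0 => i _; rewrite sqr_ge0.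
have B0 : 0 <= B by apply: sumr_ge0 => i _; rewrite sqr_ge0.
have G0 : 0 <= G by apply: sumr_ge0 => i _; rewrite sqr_ge0.
have := minkowski2D (Num.sqrt A) (a n) (Num.sqrt B) (b n).
rewrite (sqr_sqrtr A0) (sqr_sqrtr B0); apply: le_trans.
rewrite ler_wsqrtr // lerD //.
  by rewrite -(sqr_sqrtr G0) ler_pXn2r ?nnegrE ?addr_ge0 ?sqrtr_ge0.
have /andP[c0 cle] := cab n.
by rewrite ler_pXn2r ?nnegrE // (le_trans c0).
Qed.

Lemma sqsum_minkowski a b c : (forall k, 0 <= c k <= a k + b k) ->
  (sqsum a < +oo)%E -> (sqsum b < +oo)%E ->
  (sqsum c < +oo)%E /\ nrm2 c <= nrm2 a + nrm2 b.
Proof.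
move=> cab afin bfin.
have s0 : 0 <= nrm2 a + nrm2 b by rewrite addr_ge0 ?nrm2_ge0.
have cle : (sqsum c <= ((nrm2 a + nrm2 b) ^+ 2)%:E)%E.
  apply: lime_le; first by apply: is_cvg_nneseries => k _ _; exact: sq_ge0.
  apply: nearW => n; rewrite sqsum_psum lee_fin ler_pXn2r ?nnegrE ?sqrtr_ge0 //.
  by apply: le_trans (psum_minkowski n cab) _; rewrite lerD ?psum_le_nrm2.
have cfin : (sqsum c < +oo)%E by apply: le_lt_trans cle _; rewrite ltry.
split=> //; move: cle; rewrite sqsum_nrm2 // lee_fin ler_pXn2r ?nnegrE ?nrm2_ge0 //.
Qed.

Lemma sqsumZ (m : R) a :
  sqsum (fun k => m * a k) = ((m ^+ 2)%:E * sqsum a)%E.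
Proof.
rewrite /sqsum -nneseriesZl => [|k _]; last exact: sq_ge0.
by apply: eq_eseriesr => k _; rewrite exprMn -EFinM.
Qed.

Lemma sqsumZ_lty (m : R) a : (sqsum a < +oo)%E ->
  (sqsum (fun k => (m * a k)%R) < +oo)%E.
Proof. by move=> /sqsum_nrm2 aE; rewrite sqsumZ aE -EFinM ltry. Qed.

Lemma nrm2Z (m : R) a : 0 <= m -> (sqsum a < +oo)%E ->
  nrm2 (fun k => m * a k) = m * nrm2 a.
Proof.
move=> m0 /sqsum_nrm2 aE.
by rewrite {1}/nrm2 sqsumZ aE -EFinM /= -exprMn sqrtr_sqr ger0_norm // mulr_ge0 ?nrm2_ge0.
Qed.

Lemma sqsum_finite a n : (forall k, (n <= k)%N -> a k = 0) -> (sqsum a < +oo)%E.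
Proof.
move=> a0; rewrite /sqsum (nneseries_split 0 n) => [|k _ /=]; last exact: sq_ge0.
rewrite add0n eseries0 => [|k nk _]; last by rewrite a0 // expr0n.
by rewrite adde0 sumEFin ltry.
Qed.

Lemma nrm2_eq0 a : (sqsum a < +oo)%E -> nrm2 a = 0 -> forall k, a k = 0.
Proof.
move=> afin a0 k; have := @psum_le_nrm2 a k.+1 afin.
rewrite a0 => le0.
have s0 : 0 <= \sum_(i < k.+1) a i ^+ 2 by apply: sumr_ge0 => i _; rewrite sqr_ge0.
have : \sum_(i < k.+1) a i ^+ 2 <= 0.
  by rewrite -sqrtr_eq0 eq_le le0 sqrtr_ge0.
rewrite big_ord_recr /= => sle0.
apply/eqP; rewrite -sqrf_eq0 eq_le sqr_ge0 andbT (le_trans _ sle0) // lerDr.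
by apply: sumr_ge0 => i _; rewrite sqr_ge0.
Qed.
End sqsum.

Section l2_space.
Variable R : realType.

Definition l2_pred : {pred nat -> R[i]} :=
  fun x => `[< (sqsum (fun k => normc (x k)) < +oo)%E >].

Record l2 := L2 { l2val :> nat -> R[i] ; l2valP : l2val \in l2_pred }.

HB.instance Definition _ := [isSub for l2val].
HB.instance Definition _ := [Choice of l2 by <:].

Lemma l2_predP (x : nat -> R[i]) :
  (x \in l2_pred) <-> (sqsum (fun k => normc (x k)) < +oo)%E.
Proof. by rewrite unfold_in; split=> [/asboolP|?]; last exact/asboolP. Qed.

Lemma normc_ge0 (z : R[i]) : 0 <= normc z.
Proof. by case: z => a b; exact: sqrtr_ge0. Qed.

Lemma ler_normcD (z w : R[i]) : normc (z + w) <= normc z + normc w.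
Proof. exact: (le_normcD (z : Rcomplex R) (w : Rcomplex R)). Qed.

Lemma normc_real (z : R[i]) : `|z| = (normc z)%:C.
Proof. by case: z. Qed.

Lemma l2_submod_closed : submod_closed l2_pred.
Proof.
split=> [|a x y /l2_predP xfin /l2_predP yfin]; apply/l2_predP.
  by apply: (@sqsum_finite _ _ 0) => k _; rewrite Normc.normc0.
apply: (proj1 (@sqsum_minkowski _ (fun k => normc a * normc (x k))
  (fun k => normc (y k)) _ _ _ _)) => //; last exact: sqsumZ_lty.
by move=> k; rewrite normc_ge0 -Normc.normcM ler_normcD.
Qed.

HB.instance Definition _ :=
  GRing.isSubmodClosed.Build R[i] (nat -> R[i]) l2_pred l2_submod_closed.
HB.instance Definition _ := [SubChoice_isSubLmodule of l2 by <:].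

Definition l2norm (x : l2) : R := nrm2 (fun k => normc (x k)).

Lemma l2_fin (x : l2) : (sqsum (fun k => normc (x k)) < +oo)%E.
Proof. by apply/l2_predP; exact: l2valP. Qed.

Lemma l2normD (x y : l2) : (l2norm (x + y))%:C <= (l2norm x)%:C + (l2norm y)%:C.
Proof.
rewrite -rmorphD lecR.
apply: (proj2 (@sqsum_minkowski _ (fun k => normc (x k))
  (fun k => normc (y k)) _ _ _ _)); try exact: l2_fin.
by move=> k; rewrite normc_ge0 ler_normcD.
Qed.

Lemma l2normZ (a : R[i]) (x : l2) : (l2norm (a *: x))%:C = `|a| * (l2norm x)%:C.
Proof.
rewrite normc_real -rmorphM; congr (_%:C).
rewrite -(nrm2Z (normc_ge0 a) (l2_fin x)); congr nrm2.
by apply/funext => k; rewrite -Normc.normcM.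
Qed.

Lemma l2norm_eq0 (x : l2) : (l2norm x)%:C = 0 -> x = 0.
Proof.
move=> /complexI x0; apply/val_inj/funext => k.
exact/Normc.eq0_normc/(nrm2_eq0 (l2_fin x) x0).
Qed.

HB.instance Definition _ :=
  Lmodule_isNormed.Build R[i] l2 l2normD l2normZ l2norm_eq0.

End l2_space.

Section basis.
Variable R : realType.
Local Notation h := (l2 R).

Lemma e_subproof (k : nat) : (fun j => (j == k)%:R : R[i]) \in @l2_pred R.
Proof.
apply/l2_predP/(@sqsum_finite _ _ k.+1) => j kj.
by rewrite gtn_eqF // Normc.normc0.
Qed.

Definition e_ (k : nat) : h := L2 (e_subproof k).

Lemma trunc_subproof (x : h) (n : nat) :
  (fun k => if (k < n)%N then x k else 0) \in @l2_pred R.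
Proof.
apply/l2_predP/(@sqsum_finite _ _ n) => j nj.
by rewrite ltnNge nj Normc.normc0.
Qed.

Definition l2trunc (x : h) (n : nat) : h := L2 (trunc_subproof x n).

Lemma l2trunc0 (x : h) : l2trunc x 0 = 0.
Proof. exact/val_inj/funext. Qed.

Lemma l2truncS (x : h) (n : nat) : l2trunc x n.+1 = x n *: e_ n + l2trunc x n.
Proof.
apply/val_inj/funext => k /=; rewrite ltnS leq_eqVlt.
change ((if (k == n) || (k < n)%N then x k else 0) =
  x n * (k == n)%:R + (if (k < n)%N then x k else 0)).
by case: eqVneq => [->|_] /=; rewrite ?ltnn ?mulr1 ?addr0 // mulr0 add0r.
Qed.

Lemma l2trunc_cvg (x : h) : l2trunc x n @[n --> \oo] --> x.
Proof.
apply/cvgrPdist_lt => eps; case: eps => r s; rewrite ltcE /= => /andP[/eqP -> r0].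
have tail n : sqsum (fun k => normc ((x - l2trunc x n) k)) =
    (\sum_(n <= k <oo) ((normc (x k)) ^+ 2)%:E)%E.
  have xE k : (x - l2trunc x n) k = if (k < n)%N then 0 else x k.
    by change (x k - (if (k < n)%N then x k else 0) = if (k < n)%N then 0 else x k);
      case: ifP => _; rewrite ?subrr ?subr0.
  rewrite /sqsum (nneseries_split 0 n) => [|k _]; last by rewrite lee_fin sqr_ge0.
  rewrite add0n big_nat big1 ?add0e => [|k /andP[_ kn]]; last first.
    by rewrite (xE k) kn Normc.normc0 expr0n.
  rewrite eseries_cond [RHS]eseries_cond; apply: eq_eseriesr => k /andP[_ nk].
  by rewrite (xE k) ltnNge nk.
have /fine_cvgP[_] : (\sum_(n <= k <oo) ((normc (x k)) ^+ 2)%:E)%E @[n --> \oo] --> 0%E.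
  by apply: nneseries_tail_cvg (l2_fin x) _ => k _; rewrite lee_fin sqr_ge0.
move=> /cvgrPdist_lt/(_ (r ^+ 2)); rewrite exprn_gt0 // => /(_ isT).
apply: filterS => n /=; rewrite -tail sub0r normrN ger0_norm; last first.
  by rewrite fine_ge0 ?sqsum_ge0.
rewrite sqsum_nrm2 ?l2_fin //= => lt2.
change ((l2norm (x - l2trunc x n))%:C < r%:C); rewrite ltcR.
by rewrite -(@ltr_pXn2r _ 2) ?nnegrE ?nrm2_ge0 // ltW.
Qed.

End basis.

Section hilbert_schmidt.
Variable R : realType.
Local Notation h := (l2 R).

(* Everywhere defined bounded operators T with \sum_k ||T e_k||^2 finite *)
Definition hs_pred : {pred h -> h} := fun T =>
  `[< [/\ linear T, continuous T &
      (sqsum (fun k => l2norm (T (e_ R k))) < +oo)%E] >].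

Record hs := HS { hsval :> h -> h ; hsvalP : hsval \in hs_pred }.

HB.instance Definition _ := [isSub for hsval].
HB.instance Definition _ := [Choice of hs by <:].

Lemma hs_predP (T : h -> h) : (T \in hs_pred) <->
  [/\ linear T, continuous T &
      (sqsum (fun k => l2norm (T (e_ R k))) < +oo)%E].
Proof. by rewrite unfold_in; split=> [/asboolP|?]; last exact/asboolP. Qed.

Lemma l2norm_ge0 (x : h) : 0 <= l2norm x.
Proof. exact: nrm2_ge0. Qed.

Lemma ler_l2normD (x y : h) : l2norm (x + y) <= l2norm x + l2norm y.
Proof. by have := l2normD x y; rewrite -rmorphD lecR. Qed.

Lemma l2normZr (a : R[i]) (x : h) : l2norm (a *: x) = normc a * l2norm x.
Proof. by apply: complexI; rewrite rmorphM l2normZ normc_real. Qed.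

Lemma continuous_comb (a : R[i]) (S T : h -> h) :
  continuous S -> continuous T -> continuous (fun x => a *: S x + T x).
Proof.
move=> Sc Tc x; apply: (@cvgD R[i] h _ (nbhs x) _ (fun x => a *: S x) T).
  exact: (@cvgZl_tmp R[i] h h (nbhs x) _ a S (S x) (@Sc x)).
exact: (@Tc x).
Qed.

Lemma hs_submod_closed : submod_closed hs_pred.
Proof.
split=> [|a S T /hs_predP[Sl Sc Sfin] /hs_predP[Tl Tc Tfin]]; apply/hs_predP.
  split=> [b x y|x|]; first by rewrite scaler0 addr0.
    exact: (@cst_continuous h h 0).
  apply: (@sqsum_finite _ _ 0) => k _; apply: complexI.
  exact: (normr0 h).
split=> [b x y|x|].
- change (a *: S (b *: x + y) + T (b *: x + y) =
    b *: (a *: S x + T x) + (a *: S y + T y)).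
  by rewrite Sl Tl (scalerDr a) (scalerDr b) !scalerA [b * a]mulrC addrACA.
- exact: continuous_comb.
- apply: (proj1 (@sqsum_minkowski _ (fun k => normc a * l2norm (S (e_ R k)))
    (fun k => l2norm (T (e_ R k))) _ _ _ _)) => //; last exact: sqsumZ_lty.
  by move=> k; rewrite l2norm_ge0 -l2normZr ler_l2normD.
Qed.

HB.instance Definition _ :=
  GRing.isSubmodClosed.Build R[i] (h -> h) hs_pred hs_submod_closed.
HB.instance Definition _ := [SubChoice_isSubLmodule of hs by <:].

Definition hsnorm (T : hs) : R := nrm2 (fun k => l2norm (T (e_ R k))).

Lemma hs_fin (T : hs) : (sqsum (fun k => l2norm (T (e_ R k))) < +oo)%E.
Proof. by have /hs_predP[] := hsvalP T. Qed.

Lemma hsnormD (S T : hs) : (hsnorm (S + T))%:C <= (hsnorm S)%:C + (hsnorm T)%:C.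
Proof.
rewrite -rmorphD lecR.
apply: (proj2 (@sqsum_minkowski _ (fun k => l2norm (S (e_ R k)))
  (fun k => l2norm (T (e_ R k))) _ _ _ _)); try exact: hs_fin.
by move=> k; rewrite l2norm_ge0 ler_l2normD.
Qed.

Lemma hsnormZ (a : R[i]) (T : hs) : (hsnorm (a *: T))%:C = `|a| * (hsnorm T)%:C.
Proof.
rewrite normc_real -rmorphM; congr (_%:C).
rewrite -(nrm2Z (normc_ge0 a) (hs_fin T)); congr nrm2.
by apply/funext => k; rewrite -l2normZr.
Qed.

Lemma hsnorm_eq0 (T : hs) : (hsnorm T)%:C = 0 -> T = 0.
Proof.
move=> /complexI T0; have Te0 k : T (e_ R k) = 0.
  by apply: l2norm_eq0; rewrite (nrm2_eq0 (hs_fin T) T0).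
have /hs_predP[Tl Tc _] := hsvalP T.
have T00 : T 0 = 0.
  by have := Tl (- 1) 0 0; rewrite scaleN1r oppr0 addr0 scaleN1r addNr.
apply/val_inj/funext => x; change (T x = 0).
have Tx : T (l2trunc x n) @[n --> \oo] --> T x.
  refine (cvg_comp (l2trunc x) T (l2trunc_cvg (x:=x)) (Tc x)).
apply: (cvg_unique _ Tx); first exact: norm_hausdorff.
have -> : (fun n => T (l2trunc x n)) = (fun=> 0); last exact: cvg_cst.
apply/funext; elim=> [|n IHn]; first by rewrite l2trunc0.
by rewrite l2truncS Tl Te0 scaler0 add0r.
Qed.

HB.instance Definition _ :=
  Lmodule_isNormed.Build R[i] hs hsnormD hsnormZ hsnorm_eq0.

End hilbert_schmidt.

(* An unbounded operator on V is represented by its graph, a subset of V * V. *)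

Section operators.
Variables (R : realType) (V : normedModType R[i]).
Implicit Types (S T : set (V * V)) (D : set V) (z : R[i]).

Definition op_dom T : set V := [set x | exists y, T (x, y)].

Definition op_res T D : set (V * V) := [set p | T p /\ D p.1].

Definition op_id : set (V * V) := [set p | p.2 = p.1].

Definition op_scale z T : set (V * V) :=
  [set p | exists2 u, T (p.1, u) & p.2 = z *: u].

Definition op_add S T : set (V * V) :=
  [set p | exists u v, [/\ S (p.1, u), T (p.1, v) & p.2 = u + v]].

Definition op_sub S T : set (V * V) := op_add S (op_scale (-1) T).

Definition op_comp S T : set (V * V) :=
  [set p | exists2 u, T (p.1, u) & S (u, p.2)].

Definition op_pow T (n : nat) : set (V * V) := iter n (op_comp T) op_id.

Definition op_app T (x : V) : V := xget 0 [set y | T (x, y)].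

Definition op_functional T := forall x y y', T (x, y) -> T (x, y') -> y = y'.

Definition closable T := op_functional (closure T).

Definition closed_op T := op_functional T /\ closed T.

Definition op_bounded T :=
  exists M : R, forall x y, T (x, y) -> `|y| <= M%:C * `|x|.

(* z is in the resolvent set when T - z is onto and bounded below, i.e. has an
   everywhere defined bounded inverse. *)
Definition resolvent_set T : set R[i] :=
  [set z | (forall y, exists x, T (x, y + z *: x)) /\
           exists M : R, forall x y, T (x, y) -> `|x| <= M%:C * `|y - z *: x|].

Definition spectrum T : set R[i]^o := ~` resolvent_set T.

Definition op_eigenspace T z : set V := [set x | T (x, z *: x)].

Definition op_eigenvalue T z := exists2 x, x != 0 & op_eigenspace T z x.

Definition isolated_eigenvalue T z :=
  op_eigenvalue T z /\ isolated (spectrum T) z.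

Definition finite_degeneracy T z :=
  exists n (b : 'I_n -> V), forall x, op_eigenspace T z x ->
    exists c : 'I_n -> R[i], x = \sum_(i < n) c i *: b i.

(* The infimum is taken in the extended reals, so that it is +oo, and not 0,
   when no eps is admissible. *)
Definition infinitesimally_small S T :=
  op_dom T `<=` op_dom S /\
  ereal_inf [set eps%:E | eps in [set eps : R | 0 < eps /\
    exists2 b : R, 0 <= b & forall x u v, S (x, u) -> T (x, v) ->
      `|u| ^+ 2 <= eps%:C * `|v| ^+ 2 + b%:C * `|x| ^+ 2]] = 0%E.

End operators.

Arguments op_id {R V}.

Section operators_on_h.
Variable R : realType.
Local Notation h := (l2 R).
Implicit Types (T : set (h * h)) (F : R -> R[i]).

Definition csum (u : nat -> R[i]) : R[i] :=
  limn (series (fun k => complex.Re (u k))) +i*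
  limn (series (fun k => complex.Im (u k))).

(* Linear in the second argument *)
Definition ip (x y : h) : R[i] := csum (fun k => (x k)^* * y k).

Definition adjoint T : set (h * h) :=
  [set p | forall q, T q -> ip p.1 q.2 = ip p.2 q.1].

Definition self_adjoint T := dense (op_dom T) /\ adjoint T = T.

Definition commutator_adj T : set (h * h) :=
  op_sub (op_comp T (adjoint T)) (op_comp (adjoint T) T).

Definition discrete_spectrum T :=
  self_adjoint T /\ forall z, spectrum T z ->
    isolated_eigenvalue T z /\ finite_degeneracy T z.

(* Same, with the kernel of T allowed to be infinite dimensional *)
Definition discrete_spectrum_off_kernel T :=
  self_adjoint T /\ forall z, spectrum T z ->
    isolated_eigenvalue T z /\ (z != 0 -> finite_degeneracy T z).

Definition trace T : R[i] := csum (fun k => ip (e_ R k) (op_app T (e_ R k))).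

(* Borel functional calculus F(T) of a self-adjoint operator T that is diagonal
   in the natural basis: F(T) e_k = F(r) e_k when T e_k = r e_k. All the
   operators to which it is applied below are of this kind. *)
Definition fcalc F T : set (h * h) :=
  [set p : h * h | forall k (r : R), T (e_ R k, r%:C *: e_ R k) ->
    p.2 k = F r * p.1 k].

(* As y ranges over l^2(N), the equation y_k = k x_k already forces x to be in
   the maximal domain; the same applies to [fcalc]. *)
Definition numop : set (h * h) := [set p : h * h | forall k, p.2 k = k%:R * p.1 k].

(* N ^ s for a real exponent s; note that 0 `^ 0 = 1 *)
Definition numpow (s : R) : set (h * h) := fcalc (fun t => (t `^ s)%:C) numop.

Definition annihilation : set (h * h) :=
  [set p : h * h | op_dom (fcalc (fun t => (Num.sqrt t)%:C) numop) p.1 /\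
           forall k, p.2 k = (Num.sqrt k.+1%:R)%:C * p.1 k.+1].

Definition nat_set (E : set nat) : set R := [set k%:R | k in E].

Definition spectral_projection (E : set R) : set (h * h) :=
  fcalc (fun t => (\1_E t)%:C) numop.

Definition gibbs (beta : R) (g : R -> R) : set (h * h) :=
  fcalc (fun t => (expR (- beta * g t))%:C) numop.

Definition rho (beta : R) (g : R -> R) : set (h * h) :=
  op_scale (trace (gibbs beta g))^-1 (gibbs beta g).

(* (N + 1) ... (N + l) *)
Definition rising_numop (l : nat) : set (h * h) :=
  \big[@op_comp R h/op_id]_(1 <= i < l.+1) op_add numop (op_scale i%:R op_id).

(* N (N - 1) ... (N - (l - 1)) *)
Definition falling_numop (l : nat) : set (h * h) :=
  \big[@op_comp R h/op_id]_(0 <= i < l) op_sub numop (op_scale i%:R op_id).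

Definition left_op T : set (hs R * hs R) := [set p : hs R * hs R | forall x, T (p.1 x, p.2 x)].

(* [hs_adjoint eta eta'] : eta' is J eta, the adjoint of eta *)
Definition hs_adjoint (eta eta' : hs R) :=
  forall x y, ip (eta x) y = ip x (eta' y).

(* j(X) = J X J *)
Definition j_op (X : set (hs R * hs R)) : set (hs R * hs R) :=
  [set p | exists eta zeta,
    [/\ hs_adjoint p.1 eta, X (eta, zeta) & hs_adjoint zeta p.2]].

(* ln Delta_0 = - beta * closure (g(N) - j(g(N))), where g(N) acts on L^2(h) by
   left composition *)
Definition araki (beta : R) (g : R -> R) : set (hs R * hs R) :=
  let gN := left_op (fcalc (fun t => (g t)%:C) numop) in
  op_scale (- beta)%:C (closure (op_sub gN (j_op gN))).

End operators_on_h.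

Arguments numop {R}.
Arguments annihilation {R}.
Arguments nat_set {R} E.
Arguments rising_numop {R} l.
Arguments falling_numop {R} l.

Section fourier.
Variable R : realType.
Implicit Types (u : R -> R) (f : R -> R[i]).

Definition smooth u := forall n x, derivable (derive1n n u) x 1.

Definition rapidly_decreasing u :=
  forall a b : nat, exists M : R, forall x, `|x ^+ a * derive1n b u x| <= M.

Definition schwartz f :=
  [/\ smooth (fun t => complex.Re (f t)), smooth (fun t => complex.Im (f t)),
      rapidly_decreasing (fun t => complex.Re (f t)) &
      rapidly_decreasing (fun t => complex.Im (f t))].

Definition fsupport f : set R := closure [set s | f s != 0].

Definition test_function f :=
  [/\ smooth (fun t => complex.Re (f t)), smooth (fun t => complex.Im (f t)) &
      compact (fsupport f)].

(* Real and imaginary parts of the integral of f(t) e^{ist} *)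
Definition fourier f (s : R) : R[i] :=
  (\int[lebesgue_measure]_(t in setT)
     (complex.Re (f t) * cos (s * t) - complex.Im (f t) * sin (s * t))) +i*
  (\int[lebesgue_measure]_(t in setT)
     (complex.Re (f t) * sin (s * t) + complex.Im (f t) * cos (s * t))).

End fourier.

(* Main.v *)
Require Import Defs.
From HB Require Import structures.
From mathcomp Require Import all_boot all_order all_algebra.
From mathcomp Require Import all_classical all_reals all_analysis.
From mathcomp Require Import complex.
Set Implicit Arguments.
Unset Strict Implicit.
Unset Printing Implicit Defensive.
Import Order.TTheory GRing.Theory Num.Theory numFieldNormedType.Exports.
Local Open Scope classical_set_scope.
Local Open Scope ring_scope.
Local Open Scope complex_scope.

(** In the natural basis every operator of the statement is a diagonal operator
or a weighted shift. A closed weighted shift is determined by its action on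
finite sequences, so closures and adjoints are read off from the weights, and
(iii) becomes an identity between falling factorials.

For [a] in [l^2], the Hilbert-Schmidt operator [x |-> (a_k x_(k+s))_k] is an
eigenvector of the Araki Hamiltonian for the eigenvalue [c] as soon as
[beta (g(k+s) - g(k)) = c] on the support of [a]. Hence all values
[beta (g(k+s) - g(k))] lie in its spectrum; as the support of the Fourier
transform of [f] meets this spectrum only in [nu], [p] is the indicator function
of [B] on the natural numbers. This gives (i) and (ii), and (vi) follows because
[X xi_0] is such an operator, with [a] supported by [B].

For (iv), the diagonal operators concerned have natural numbers as entries, so
all points of their spectra are isolated. For (v), the factors
[(k+1)...(k+l)] and [k...(k-l+1)] differ by [O(k^(l-1))]. *)

(** Domains are the main obstacle. If [l > 0] and infinitely many naturals lie outside [B], then [X]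
    on [D(N^(l/2))] is not closed, since that domain constrains coordinates which [p(N)] discards.
    So [X^* X] and the commutator carry the domain of [X] as a restriction, which goes away for the
    closure of [X] or for cofinite [B]. An infinite complement of [B] also makes the kernels
    infinite-dimensional, whence the spectra taken off the kernel in (iv). Products of weighted
    shifts are tamed by one fact: nonzero weights are square roots of positive integers, hence at
    least 1, so the intermediate vector is square-summable whenever the final one is. A second
    obstacle sits below [l]: there [N - l] has negative eigenvalues, where [g] vanishes, so
    [p(j - l)] is 1 when [g(j) = g(m) - g(n)]. The falling factorial kills these entries in (iii),
    while (ii) has to cut them off or exclude them. *)

Section square_summable.
Variable R : realType.
Implicit Types (a b : nat -> R).

Definition unshift (V : nmodType) (s : nat) (u : nat -> V) : nat -> V :=
  fun j => if (j < s)%N then 0 else u (j - s)%N.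

Lemma unshiftE (V : nmodType) s (u : nat -> V) k : unshift s u (k + s)%N = u k.
Proof. by rewrite /unshift ltnNge leq_addl addnK. Qed.

Lemma nrm2_cst0 : nrm2 (fun=> 0 : R) = 0.
Proof.
have := @nrm2Z R 0 (fun=> 0) (lexx 0) (@sqsum_finite _ _ 0 (fun _ _ => erefl)).
by rewrite !mul0r.
Qed.

Lemma nrm2_le a b : (forall k, 0 <= a k <= b k) -> (sqsum b < +oo)%E ->
  (sqsum a < +oo)%E /\ nrm2 a <= nrm2 b.
Proof.
move=> ab bfin; rewrite -[nrm2 b]addr0 -nrm2_cst0.
by apply: sqsum_minkowski => //; [move=> k; rewrite addr0|exact: (@sqsum_finite _ _ 0)].
Qed.

Lemma le_nrm2 a k : (sqsum a < +oo)%E -> a k <= nrm2 a.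
Proof.
move=> afin; apply: le_trans (psum_le_nrm2 k.+1 afin).
apply: le_trans (ler_norm _) _; rewrite -sqrtr_sqr ler_wsqrtr // big_ord_recr /=.
by rewrite lerDr sumr_ge0 // => i _; rewrite sqr_ge0.
Qed.

Lemma sqsum_unshift s a : sqsum (unshift s a) = sqsum a.
Proof.
have ge0 k : (0 <= (unshift s a k ^+ 2)%:E)%E by rewrite lee_fin sqr_ge0.
rewrite /sqsum (nneseries_split 0 s) // add0n big_nat big1 => [|k /andP[_ ks]].
  rewrite add0e -(nneseries_addn s) //.
  by apply: eq_eseriesr => k _; rewrite unshiftE.
by rewrite /unshift ks expr0n.
Qed.

Lemma sqsum_shift s a : (sqsum (fun k => a (k + s)%N) <= sqsum a)%E.
Proof.
have ge0 k : (0 <= (a k ^+ 2)%:E)%E by rewrite lee_fin sqr_ge0.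
rewrite /sqsum (@nneseries_addn _ (fun k => ((a k) ^+ 2)%:E)) //.
rewrite [leRHS](nneseries_split 0 s) // add0n leeDr //.
by rewrite sumEFin lee_fin sumr_ge0 // => i _; rewrite sqr_ge0.
Qed.

End square_summable.

(** * Sequences in [l^2]: membership, coordinates, scalar product *)

Section sequences_in_l2.
Variable R : realType.
Local Notation C := R[i].
Local Notation h := (l2 R).
Local Notation l2p := (@l2_pred R).
Implicit Types (a b u v : nat -> C) (x y : h).

(** Two dominating sequences allow comparison in a graph norm: [u] and [v] are typically a vector
    and its image, and the vector itself pays for the finitely many indices where the image gives no
    control. *)
Lemma l2_pred_dom (M : R) a u v :
  (forall k, normc (a k) <= M * normc (u k) + M * normc (v k)) ->
  u \in l2p -> v \in l2p -> a \in l2p.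
Proof.
move=> auv /l2_predP ufin /l2_predP vfin; apply/l2_predP.
apply: (proj1 (@sqsum_minkowski _ (fun k => M * normc (u k))
  (fun k => M * normc (v k)) _ _ _ _)); try exact: sqsumZ_lty.
by move=> k; rewrite normc_ge0 auv.
Qed.

Lemma l2_pred_le (M : R) a u :
  (forall k, normc (a k) <= M * normc (u k)) -> u \in l2p -> a \in l2p.
Proof.
move=> au ul2; apply: (@l2_pred_dom M a u (fun=> 0)) => // [k|].
  by rewrite Normc.normc0 mulr0 addr0.
exact: (l2valP (0 : h)).
Qed.

Lemma l2_pred_finite a n : (forall k, (n <= k)%N -> a k = 0) -> a \in l2p.
Proof.
by move=> a0; apply/l2_predP/(@sqsum_finite _ _ n) => k /a0 ->; rewrite Normc.normc0.
Qed.

Lemma l2_pred_unshift s u : u \in l2p -> unshift s u \in l2p.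
Proof.
move=> /l2_predP ufin; apply/l2_predP; rewrite -(sqsum_unshift s) in ufin.
congr (_ < _)%E : ufin; congr sqsum; apply/funext => k; rewrite /unshift.
by case: ifP; rewrite ?Normc.normc0.
Qed.

Lemma l2_pred_shift s u : u \in l2p -> (fun k => u (k + s)%N) \in l2p.
Proof.
move=> /l2_predP ufin; apply/l2_predP; apply: le_lt_trans ufin.
exact: (@sqsum_shift _ s (fun k => normc (u k))).
Qed.

Lemma normc_coord x k : normc (x k) <= l2norm x.
Proof. exact: (le_nrm2 k (l2_fin x)). Qed.

Lemma l2_pred_mul x y : (fun k => x k * y k) \in l2p.
Proof.
apply: (@l2_pred_le (l2norm x) _ y) => [k|]; last exact: l2valP.
by rewrite Normc.normcM ler_wpM2r ?normc_ge0 ?normc_coord.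
Qed.

Lemma normc_realC (r : R) : normc r%:C = `|r|.
Proof. by rewrite /= expr0n addr0 sqrtr_sqr. Qed.

Lemma l2P x y : x = y <-> forall k, x k = y k.
Proof. by split=> [->//|xy]; apply/val_inj/funext. Qed.

Lemma coordD x y k : (x + y) k = x k + y k. Proof. by []. Qed.
Lemma coordB x y k : (x - y) k = x k - y k. Proof. by []. Qed.
Lemma coordZ (c : C) x k : (c *: x) k = c * x k. Proof. by []. Qed.
Lemma coord_e i k : e_ R i k = (k == i)%:R. Proof. by []. Qed.

Lemma l2norm_le (M : R) x y : 0 <= M ->
  (forall k, normc (x k) <= M * normc (y k)) -> l2norm x <= M * l2norm y.
Proof.
move=> M0 xy; rewrite -nrm2Z // ?l2_fin //.
apply: (proj2 (nrm2_le _ _)); last exact/sqsumZ_lty/l2_fin.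
by move=> k; rewrite normc_ge0 xy.
Qed.

Lemma l2norm_e k : l2norm (e_ R k) = 1.
Proof.
(* [e_k] is [e_0] moved right by [k], which leaves a series with a single nonzero term at index
   0. *)
have -> : l2norm (e_ R k) = nrm2 (unshift k (fun j => if (j < 1)%N then 1 else 0 : R)).
  congr nrm2; apply/funext => j; rewrite coord_e /unshift.
  case: (ltngtP j k) => [||->]; rewrite ?Normc.normc0 ?subnn ?ltnn ?Normc.normc1 //.
  by move=> kj; rewrite ltnS leqn0 subn_eq0 leqNgt kj.
rewrite /nrm2 sqsum_unshift /sqsum (nneseries_split 0 1) //; last first.
  by move=> j _; rewrite lee_fin sqr_ge0.
rewrite add0n big_nat1 eseries0 /= ?expr1n ?addr0 ?sqrtr1 //.
by move=> j j1 _; rewrite ltnNge j1 expr0n.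
Qed.

Lemma e_neq0 k : e_ R k != 0.
Proof.
apply/eqP => /(congr1 (@l2norm R)); rewrite l2norm_e => e0.
have /eqP := complexI (normr0 h); change ((l2norm (0 : h)) == 0 -> False).
by rewrite -e0 oner_eq0.
Qed.

(* Holds also for divergent series, both sides being the same junk value. *)
Lemma csum_shift s u : (forall j, (j < s)%N -> u j = 0) ->
  csum (fun k => u (k + s)%N) = csum u.
Proof.
move=> u0; have lim_shift (w : nat -> R) : (forall j, (j < s)%N -> w j = 0) ->
    limn (series (fun k => w (k + s)%N)) = limn (series w).
  move=> w0; have -> : series (fun k => w (k + s)%N) =
      (fun n => series w (n + s)%N).
    apply/funext => n; rewrite /series /= [RHS](big_cat_nat _ (n := s)) ?leq_addl //=.
    rewrite [X in _ = X + _]big_nat [X in _ = X + _]big1 ?add0r; last first.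
      by move=> i /andP[_ /w0].
    by rewrite -{2}[s]add0n big_addn addnK.
  by rewrite /lim_in; congr (get _); apply/funext => z; rewrite cvg_shiftn.
by congr (_ +i* _); apply: lim_shift => j /u0 ->.
Qed.

Lemma csum_single j u : (forall k, k != j -> u k = 0) -> csum u = u j.
Proof.
move=> u0; have lim1 (w : nat -> R) : (forall k, k != j -> w k = 0) ->
    limn (series w) = w j.
  move=> w0; apply: cvg_lim => //; rewrite -(cvg_shiftn j.+1).
  have -> : [sequence series w (n + j.+1)%N]_n = cst (w j); last exact: cvg_cst.
  apply/funext => n; rewrite /series /=.
  rewrite (big_cat_nat _ (n := j)) ?ltn_addl //=; last by rewrite addnS -addSn leq_addl.
  rewrite [X in _ + X]big_ltn; last by rewrite addnS ltnS leq_addl.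
  rewrite !big_nat !big1 ?add0r ?addr0 // => i /andP[ji ij]; apply: w0.
    by rewrite gtn_eqF.
  by rewrite ltn_eqF.
rewrite /csum !lim1; first by case: (u j).
- by move=> k /u0 ->.
- by move=> k /u0 ->.
Qed.

Lemma ip_el k y : ip (e_ R k) y = y k.
Proof.
rewrite /ip (@csum_single k) ?coord_e ?eqxx ?rmorph1 ?mul1r //.
by move=> j /negPf jk; rewrite coord_e jk rmorph0 mul0r.
Qed.

Lemma ip_er k x : ip x (e_ R k) = (x k)^*.
Proof.
rewrite /ip (@csum_single k) ?coord_e ?eqxx ?mulr1 //.
by move=> j /negPf jk; rewrite coord_e jk mulr0.
Qed.

End sequences_in_l2.

(** * Graphs of operators: closure, spectrum, restriction of domains *)

Section graphs.
Variables (R : realType) (V : normedModType R[i]).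
Implicit Types (T : set (V * V)).

Lemma ltc_normP (e : R[i]) : 0 < e -> exists2 r : R, 0 < r & e = r%:C.
Proof. by case: e => r s; rewrite ltcE /= => /andP[/eqP -> r0]; exists r. Qed.

Lemma closure_graphP T (p : V * V) : closure T p <->
  forall e : R, 0 < e ->
    exists q, [/\ T q, `|p.1 - q.1| < e%:C & `|p.2 - q.2| < e%:C].
Proof.
split=> [Tp e e0|Tp U [[P Q] [/= /nbhs_normP[e1 e10 Pe] /nbhs_normP[e2 e20 Qe]] PQ]].
  have eC : 0 < e%:C by rewrite ltcR.
  have [|q [Tq [q1 q2]]] := Tp [set q | ball p.1 e%:C q.1 /\ ball p.2 e%:C q.2].
    by exists (ball p.1 e%:C, ball p.2 e%:C) => //; split; exact: nbhsx_ballx.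
  by exists q; move: q1 q2; rewrite -!ball_normE.
have [r1 r10 e1E] := ltc_normP e10; have [r2 r20 e2E] := ltc_normP e20.
have [|q [Tq q1 q2]] := Tp (Num.min r1 r2); first by rewrite lt_min r10.
exists q; split=> //; apply: (PQ q); split=> /=.
  by apply: Pe => /=; rewrite e1E (lt_le_trans q1) // lecR ge_min lexx.
by apply: Qe => /=; rewrite e2E (lt_le_trans q2) // lecR ge_min lexx orbT.
Qed.

Lemma eigenvalue_spectrum T z : op_eigenvalue T z -> spectrum T z.
Proof.
move=> [x x0 Tx] [_ [M /(_ _ _ Tx)]]; rewrite subrr normr0 mulr0 normr_le0.
by move/eqP => xE; rewrite xE eqxx in x0.
Qed.

Lemma isolated_sub (S S' : set R[i]^o) z :
  S `<=` S' -> S z -> isolated S' z -> isolated S z.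
Proof.
move=> SS' Sz [_ [U Uz US']]; split; first exact/mem_set.
exists U => //; apply/seteqP; split=> [w [Uw Sw]|w /= ->].
  by rewrite -US'; split=> //; exact: SS'.
by split=> //; exact: nbhs_singleton.
Qed.

Lemma op_comp_resr S T D :
  op_comp S (op_res T D) = op_res (op_comp S T) D :> set (V * V).
Proof.
apply/seteqP; split=> -[x y].
  by move=> [u [Tu Du] Su]; split=> //; exists u.
by move=> [[u Tu Su] Du]; exists u.
Qed.

Lemma op_sub_resr S T D :
  op_sub S (op_res T D) = op_res (op_sub S T) D :> set (V * V).
Proof.
apply/seteqP; split=> -[x y].
  by move=> [u [v [Su [w [Tw Dx] vw] yE]]]; split=> //; exists u, v; split=> //; exists w.
by move=> [[u [v [Su [w Tw vw] yE]]] Dx]; exists u, v; split=> //; exists w.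
Qed.

Lemma op_res_id T D : op_dom T `<=` D -> op_res T D = T.
Proof.
move=> TD; apply/seteqP; split=> [p []//|[x y] Txy]; split=> //.
by apply: TD; exists y.
Qed.

End graphs.

(** * Diagonal operators and weighted shifts on [h] *)

Section weighted_shifts.
Variable R : realType.
Local Notation C := R[i].
Local Notation h := (l2 R).
Local Notation l2p := (@l2_pred R).
Implicit Types (a d : nat -> C) (x y : h) (T : set (h * h)).

Lemma conjcE (z : C) : Num.conj z = conjc z.
Proof. by []. Qed.

Lemma conjcM (z w : C) : conjc (z * w) = conjc z * conjc w.
Proof. exact: rmorphM. Qed.

Definition diag d : set (h * h) := [set p : h * h | forall k, p.2 k = d k * p.1 k].

Definition wshift s a : set (h * h) :=
  [set p : h * h | forall k, p.2 k = a k * p.1 (k + s)%N].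

Definition bshift s a : set (h * h) :=
  [set p : h * h | forall j, p.2 j = unshift s (fun k => a k * p.1 k) j].

Lemma wshift0 d : wshift 0 d = diag d.
Proof. by apply/funext => p; apply/propext; split=> H k; move: (H k); rewrite addn0. Qed.

Lemma diag_dom d x : op_dom (diag d) x <-> (fun k => d k * x k) \in l2p.
Proof.
split=> [[y yE]|dx]; last by exists (L2 dx).
by apply: (@l2_pred_le _ 1 _ y) (l2valP y) => k; rewrite mul1r (yE k).
Qed.

Lemma wshift_dom s a x : op_dom (wshift s a) x <-> (fun k => a k * x (k + s)%N) \in l2p.
Proof.
split=> [[y yE]|dx]; last by exists (L2 dx).
by apply: (@l2_pred_le _ 1 _ y) (l2valP y) => k; rewrite mul1r (yE k).
Qed.

Lemma normc0P (z : C) : (forall e : R, 0 < e -> normc z <= e) -> z = 0.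
Proof.
move=> z0; apply: Normc.eq0_normc; apply/eqP; rewrite eq_le normc_ge0 andbT.
by apply/ler_addgt0Pl => e /z0; rewrite addr0.
Qed.

(** Norm convergence of both components implies convergence of each coordinate, and the graph is cut
    out by one linear relation between two coordinates for each [k]. *)
Lemma closed_wshift s a : closure (wshift s a) `<=` wshift s a.
Proof.
move=> p /closure_graphP clp k; apply/eqP; rewrite -subr_eq0; apply/eqP/normc0P => e e0.
have c0 : 0 < 1 + normc (a k) by rewrite ltr_pwDl ?normc_ge0.
have [|q [Tq]] := clp (e / (1 + normc (a k))); first by rewrite divr_gt0.
rewrite -[`|p.1 - _|]/((l2norm _)%:C) -[`|p.2 - _|]/((l2norm _)%:C) !ltcR => q1 q2.
have -> : p.2 k - a k * p.1 (k + s)%N =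
    (p.2 - q.2) k - a k * (p.1 - q.1) (k + s)%N.
  by rewrite !coordB Tq mulrBr opprB addrA addrNK.
apply: le_trans (ler_normcD _ _) _; rewrite [normc (- _)]normcN Normc.normcM.
rewrite (_ : e = e / (1 + normc (a k)) + normc (a k) * (e / (1 + normc (a k)))); last first.
  transitivity ((1 + normc (a k)) * (e / (1 + normc (a k)))).
    by rewrite mulrC divfK // gt_eqF.
  by rewrite mulrDl mul1r.
apply: lerD; first exact: le_trans (normc_coord _ _) (ltW q2).
by rewrite ler_wpM2l ?normc_ge0 // (le_trans (normc_coord _ _)) // ltW.
Qed.

Lemma l2trunc_near x (e : R) : 0 < e ->
  exists n0, forall n, (n0 <= n)%N -> l2norm (x - l2trunc x n) < e.
Proof.
move=> e0; have := @l2trunc_cvg R x; move/cvgrPdist_lt => /(_ e%:C).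
rewrite ltcR => /(_ e0) [n0 _ n0P]; exists n0 => n /n0P.
by rewrite -[`|x - _|]/((l2norm _)%:C) ltcR.
Qed.

Definition finsupp x := exists n, forall k, (n <= k)%N -> x k = 0.

(* The finite sequences are a core, so such a [T] has the closure and the adjoint
   of the full weighted shift. *)
Definition between_shift s a T := T `<=` wshift s a /\
  forall x y, wshift s a (x, y) -> finsupp x -> T (x, y).

Lemma l2truncE x n k : l2trunc x n k = if (k < n)%N then x k else 0.
Proof. by []. Qed.

Lemma finsupp_trunc x n : finsupp (l2trunc x n).
Proof. by exists n => k; rewrite l2truncE ltnNge => ->. Qed.

Lemma finsupp_e k : finsupp (e_ R k).
Proof. by exists k.+1 => j kj; rewrite coord_e gtn_eqF. Qed.

Lemma closure_between s a T : between_shift s a T -> closure T = wshift s a.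
Proof.
move=> [Tsub Tcore]; apply/seteqP; split.
  by apply: subset_trans (closed_wshift (s := s) (a := a)); exact: closure_subset.
move=> [x y] xy; apply/closure_graphP => e e0.
have [n1 n1P] := l2trunc_near x e0; have [n2 n2P] := l2trunc_near y e0.
pose n := maxn n1 n2.
(* Coordinate [k] of the image reads coordinate [k + s] of the argument, so these two cut-offs keep
   the pair on the graph. *)
exists (l2trunc x (n + s), l2trunc y n); split=> /=; last 2 first.
- rewrite -[`|_|]/((l2norm _)%:C) ltcR n1P //.
  exact: leq_trans (leq_maxl n1 n2) (leq_addr _ _).
- by rewrite -[`|_|]/((l2norm _)%:C) ltcR n2P // leq_maxr.
apply: Tcore; last exact: finsupp_trunc.
move=> k /=; rewrite ltn_add2r; case: ifP => _; last by rewrite mulr0.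
exact: xy.
Qed.

Lemma finsupp_dense (D : set h) : (forall x, finsupp x -> D x) -> dense D.
Proof.
move=> finD O [x Ox] Oo.
have /nbhs_normP[e e0 eO] : nbhs x O by exact: open_nbhs_nbhs.
have [r r0 eE] := ltc_normP e0; have [n nP] := l2trunc_near x r0.
exists (l2trunc x n); split; last exact/finD/finsupp_trunc.
by apply: eO => /=; rewrite -[`|_|]/((l2norm _)%:C) eE ltcR nP.
Qed.

Lemma finsupp_mul_l2 u x : finsupp x -> (fun k => u k * x k) \in l2p.
Proof. by move=> [n xn]; apply: (@l2_pred_finite _ _ n) => k /xn ->; rewrite mulr0. Qed.

Lemma finsupp_wshift_l2 s u x : finsupp x -> (fun k => u k * x (k + s)%N) \in l2p.
Proof.
move=> [n xn]; apply: (@l2_pred_finite _ _ n) => k nk.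
by rewrite xn ?mulr0 // (leq_trans nk) ?leq_addr.
Qed.

(** Testing against [e_j], which lies in the core, already determines coordinate [j] of an adjoint
    pair. Conversely, the pairing identity is a reindexing of the two series by [s], valid on the
    whole weighted shift. *)
Lemma adjoint_between s a T : between_shift s a T ->
  adjoint T = bshift s (fun k => (a k)^*).
Proof.
move=> [Tsub Tcore]; apply/seteqP; split=> -[x y] /=.
  move=> adj j.
  pose z : h := L2 (finsupp_wshift_l2 s a (finsupp_e j)).
  have Tz : T (e_ R j, z) by apply: Tcore; [move=> k|exact: finsupp_e].
  have := adj _ Tz; rewrite /= ip_er => /(congr1 (@conjc R)).
  rewrite conjcK => <-; rewrite /ip /unshift; case: ltnP => [js|sj].
    rewrite (@csum_single _ j) ?coord_e; last first.
      move=> k kj; rewrite -[z k]/(a k * e_ R j (k + s)%N) coord_e.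
      by rewrite gtn_eqF ?mulr0 // (leq_trans js) ?leq_addl.
    rewrite -[z j]/(a j * e_ R j (j + s)%N) coord_e gtn_eqF ?mulr0 ?rmorph0 //.
    by rewrite (leq_trans js) ?leq_addl.
  have zE k : z k = a k * (k == (j - s)%N)%:R.
    by rewrite -[z k]/(a k * e_ R j (k + s)%N) coord_e -(eqn_add2r s k) subnK.
  rewrite (@csum_single _ (j - s)%N) ?zE ?eqxx ?mulr1 ?conjcM ?conjcE ?conjcK 1?mulrC //.
  by move=> k /negPf kj; rewrite zE kj !mulr0.
move=> xy [u v] /Tsub /= uv; rewrite /ip -[RHS](@csum_shift _ s) => [|j js].
  congr csum; apply/funext => k; rewrite (xy (k + s)%N) unshiftE (uv k) !conjcE conjcM conjcK.
  by rewrite mulrCA mulrA.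
by rewrite (xy j) /unshift js rmorph0 mul0r.
Qed.

Lemma diag_functional d : op_functional (diag d).
Proof. by move=> x y y' yE y'E; apply/l2P => k; rewrite (yE k) (y'E k). Qed.

Lemma wshift_functional s a : op_functional (wshift s a).
Proof. by move=> x y y' yE y'E; apply/l2P => k; rewrite (yE k) (y'E k). Qed.

Lemma diag_self_adjoint d : (forall k, (d k)^* = d k) -> self_adjoint (diag d).
Proof.
move=> dr; split.
  by apply: finsupp_dense => x /(finsupp_mul_l2 d) /diag_dom.
rewrite -wshift0 (@adjoint_between 0 d); last by split.
apply/seteqP; split=> -[x y] /= H k; move: (H k); rewrite /unshift.
  by rewrite ltn0 subn0 addn0 dr.
by rewrite ltn0 subn0 addn0 dr.
Qed.

(** The composite also requires [d x] to be square-summable; the hypothesis bounds it by [x] and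
    [a d x], so the composite has the maximal domain. *)
Lemma op_comp_diag a d (M : R) :
  (forall k, normc (d k) <= M + M * normc (a k * d k)) ->
  op_comp (diag a) (diag d) = diag (fun k => a k * d k).
Proof.
move=> H; apply/seteqP; split=> -[x y] /=.
  by move=> [u uE yE] k; rewrite (yE k) (uE k) mulrA.
move=> yE; have ul2 : (fun k => d k * x k) \in l2p.
  apply: (@l2_pred_dom _ M _ x y); try exact: l2valP.
  move=> k; rewrite (yE k) /= [normc (d k * _)]Normc.normcM.
  by rewrite [normc (_ * x k)]Normc.normcM mulrA -mulrDl ler_wpM2r ?normc_ge0.
by exists (L2 ul2) => k //=; rewrite (yE k) /= mulrA.
Qed.

Lemma op_comp_diag_ge1 a d K : (forall k, (K <= k)%N -> 1 <= normc (a k)) ->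
  op_comp (diag a) (diag d) = diag (fun k => a k * d k).
Proof.
move=> aK; apply: (@op_comp_diag _ _ (1 + \sum_(i < K) normc (d i))) => k.
set S := \sum_(i < K) _; have S0 : 0 <= S by rewrite sumr_ge0 // => i _; exact: normc_ge0.
have [Kk|kK] := leqP K k.
  apply: le_trans (_ : 1 * normc (a k * d k) <= _).
    by rewrite mul1r Normc.normcM ler_peMl ?normc_ge0 ?aK.
  rewrite -[leLHS]add0r lerD ?addr_ge0 // ler_wpM2r ?normc_ge0 //.
  by rewrite lerDl.
rewrite -[leLHS]addr0 lerD ?mulr_ge0 ?addr_ge0 ?normc_ge0 //.
rewrite /S (bigD1 (Ordinal kK)) //= addrCA lerDl addr_ge0 //.
by rewrite sumr_ge0 // => i _; exact: normc_ge0.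
Qed.

Lemma big_op_comp_diag (I : Type) (r : seq I) (a : I -> nat -> C) :
  (forall i, exists K, forall k, (K <= k)%N -> 1 <= normc (a i k)) ->
  \big[@op_comp R h/op_id]_(i <- r) diag (a i) = diag (fun k => \prod_(i <- r) a i k).
Proof.
move=> aK; elim: r => [|i r IHr].
  rewrite big_nil; apply/seteqP; split=> -[x y] /=.
    by rewrite /op_id /= => -> k; rewrite big_nil mul1r.
  by move=> xy; apply/l2P => k; rewrite (xy k) big_nil mul1r.
rewrite big_cons IHr; have [K aiK] := aK i; rewrite (op_comp_diag_ge1 _ aiK).
by congr diag; apply/funext => k; rewrite big_cons.
Qed.

(** A bounded perturbation does not change the domain: [a_k x_k] is the difference of
    [(a_k + z) x_k] and [z x_k]. *)
Lemma op_add_diag a z : op_add (diag a) (op_scale z op_id) = diag (fun k => a k + z).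
Proof.
apply/seteqP; split=> -[x y] /=.
  move=> [u [v [uE [w /= wE ->] ->]]] k.
  by rewrite /op_id /= in wE; rewrite wE coordD coordZ (uE k) /= mulrDl.
move=> yE; have ul2 : (fun k => a k * x k) \in l2p.
  apply: (@l2_pred_dom _ (1 + normc z) _ y x); try exact: l2valP.
  move=> k; rewrite -mulrDr (yE k) /=.
  have -> : a k * x k = (a k + z) * x k - z * x k by rewrite mulrDl addrK.
  apply: le_trans (ler_normcD _ _) _; rewrite [normc (- _)]normcN [normc (z * _)]Normc.normcM.
  rewrite mulrDr lerD //; first by rewrite ler_peMl ?normc_ge0 // lerDl normc_ge0.
  by rewrite ler_wpM2r ?normc_ge0 // lerDr.
exists (L2 ul2), (z *: x); split=> //=; first by exists x.
by apply/l2P => k; rewrite coordD coordZ (yE k) /= mulrDl.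
Qed.

Lemma op_sub_diag a z : op_sub (diag a) (op_scale z op_id) = diag (fun k => a k - z).
Proof.
rewrite -op_add_diag /op_sub; congr op_add; apply/seteqP; split=> -[x y] /=.
  by move=> [u [v vE /= ->] /= ->]; exists v => //=; rewrite scalerA mulN1r.
by move=> [u uE /= ->]; exists (z *: u); [exists u|rewrite /= scalerA mulN1r].
Qed.

Lemma numop_diag : @numop R = diag (fun k => (k%:R)%:C).
Proof.
apply/seteqP; split=> p /= H k; rewrite (H k); congr (_ * _).
  by rewrite -(rmorph_nat (real_complex R)).
by rewrite -(rmorph_nat (real_complex R)).
Qed.

Lemma fcalc_diag (F : R -> C) (d : nat -> R) :
  fcalc F (diag (fun k => (d k)%:C)) = diag (fun k => F (d k)).
Proof.
apply/seteqP; split=> -[x y] /= H k.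
  by apply: H => j; rewrite coordZ coord_e; case: eqVneq => [->|_] //=; rewrite !mulr0.
(* The eigenvalue equation read at coordinate [k] forces [r = d k]. *)
move=> r /(_ k); rewrite coordZ coord_e eqxx !mulr1 => /complexI ->; exact: H.
Qed.

Lemma op_pow_diag d n K : (forall k, (K <= k)%N -> 1 <= normc (d k)) ->
  op_pow (diag d) n = diag (fun k => d k ^+ n).
Proof.
move=> dK; elim: n => [|n IHn].
  rewrite /op_pow /op_id; apply/seteqP; split=> -[x y] /=.
    by move=> -> k; rewrite mul1r.
  by move=> yE; apply/l2P => k; rewrite (yE k) mul1r.
rewrite /op_pow /= -/(op_pow _ _) IHn (op_comp_diag_ge1 _ dK).
by congr diag; apply/funext => k; rewrite exprS.
Qed.

Lemma diag_resolvent d z (delta : R) : 0 < delta ->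
  (forall k, delta <= normc (d k - z)) -> resolvent_set (diag d) z.
Proof.
move=> d0 dz; have dz0 k : d k - z != 0.
  by apply/eqP => E; have := dz k; rewrite E Normc.normc0 leNgt d0.
split=> [y|].
  have xl2 : (fun k => (d k - z)^-1 * y k) \in l2p.
    apply: (@l2_pred_le _ delta^-1 _ y); last exact: l2valP.
    move=> k; rewrite Normc.normcM Normc.normcV ler_wpM2r ?normc_ge0 //.
    by rewrite lef_pV2 ?posrE // (lt_le_trans d0).
  exists (L2 xl2) => k.
  change (y k + z * ((d k - z)^-1 * y k) = d k * ((d k - z)^-1 * y k)).
  by rewrite -{1}[y k](mulVKf (dz0 k)) -mulrDl subrK.
exists delta^-1 => x y xy.
rewrite -[`|x|]/((l2norm _)%:C) -[`|_ - _|]/((l2norm _)%:C) -rmorphM lecR.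
apply: l2norm_le; first by rewrite invr_ge0 ltW.
move=> k; rewrite coordB coordZ (xy k) /= -mulrBl Normc.normcM mulrA.
rewrite ler_peMl ?normc_ge0 // mulrC ler_pdivlMr // mul1r; exact: dz.
Qed.

Lemma diag_e d k : diag d (e_ R k, d k *: e_ R k).
Proof. by move=> j; rewrite coordZ coord_e; case: eqVneq => [->|_] //=; rewrite !mulr0. Qed.

Lemma diag_eigenvalue d k : op_eigenvalue (diag d) (d k).
Proof. by exists (e_ R k); [exact: e_neq0|exact: diag_e]. Qed.

End weighted_shifts.

(** * Diagonal operators with natural entries *)

Section natural_diagonals.
Variable R : realType.
Local Notation C := R[i].
Local Notation h := (l2 R).
Implicit Types (d : nat -> nat) (z : C).

Definition ndiag d := diag (fun k => (d k)%:R : C).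

Lemma normc_nat n : normc (n%:R : C) = n%:R.
Proof. by rewrite -(rmorph_nat (real_complex R)) normc_realC normr_nat. Qed.

(** One gap serves two purposes: outside the naturals it bounds the resolvent, at a natural it
    isolates the eigenvalue. *)
Lemma nat_gap z :
  exists2 delta : R, 0 < delta & forall n : nat, n%:R != z -> delta <= normc (n%:R - z).
Proof.
have gap N : exists2 delta : R, 0 < delta <= 1 &
    forall n : nat, (n < N)%N -> n%:R != z -> delta <= normc (n%:R - z).
  elim: N => [|N [delta /andP[d0 d1] IHN]]; first by exists 1; rewrite ?ltr01 ?lexx.
  have [Nz|Nz] := eqVneq (N%:R : C) z.
    exists delta; rewrite ?d0 // => n; rewrite ltnS leq_eqVlt => /orP[/eqP ->|].
      by rewrite Nz eqxx.
    exact: IHN.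
  exists (Num.min delta (normc (N%:R - z))).
    rewrite lt_min d0 ge_min d1 andbT lt_neqAle normc_ge0 andbT eq_sym.
    by apply/eqP => /Normc.eq0_normc /eqP; rewrite subr_eq0 (negPf Nz).
  move=> n; rewrite ltnS leq_eqVlt ge_min => /orP[/eqP -> _|/IHN nz /nz -> //].
  by rewrite lexx orbT.
(* From this bound on, [n] exceeds [|z| + 1], so its distance to [z] is at least 1; only finitely
   many [n] remain for the minimum. *)
have [delta /andP[d0 d1] small] := gap (Num.truncn (normc z)).+2.
exists delta => // n nz; have [/small ->//|big] := ltnP n (Num.truncn (normc z)).+2.
apply: le_trans d1 _; have := ler_normcD (n%:R - z) z; rewrite subrK normc_nat.
rewrite -lerBlDr; apply: le_trans; rewrite lerBrDr addrC.
apply: le_trans (_ : (Num.truncn (normc z)).+2%:R <= _); last by rewrite ler_nat.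
by rewrite -natr1 lerD2r ltW // truncnS_gt.
Qed.

(** The spectrum adds no limit points to the entries, because a set of naturals is closed. *)
Lemma ndiag_spectrum d z : spectrum (ndiag d) z -> exists k, z = (d k)%:R.
Proof.
move=> sz; apply: contrapT => nz; apply: sz.
have [delta d0 gap] := nat_gap z; apply: (diag_resolvent d0) => k.
by apply: gap; apply/eqP => E; apply: nz; exists k.
Qed.

Lemma ndiag_isolated d k : isolated_eigenvalue (ndiag d) (d k)%:R.
Proof.
have ev := @diag_eigenvalue R (fun k => (d k)%:R) k; split=> //.
have sp := eigenvalue_spectrum ev; split; first exact/mem_set.
have [delta d0 gap] := nat_gap (d k)%:R.
exists (ball ((d k)%:R : R[i]^o) delta%:C); first by apply: nbhsx_ballx; rewrite ltcR.
apply/seteqP; split=> [w [wb /ndiag_spectrum[j wE]]|w -> /=]; last first.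
  by split=> //; apply: ballxx; rewrite ltcR.
apply/eqP; apply: contraPT wb => wk; rewrite -ball_normE /= distrC wE.
apply/negP; rewrite normc_real ltcR -leNgt; apply: gap; by rewrite -wE.
Qed.

(** An eigenvector for [v] is supported where [d] takes the value [v], hence below [K]. *)
Lemma ndiag_degeneracy d v K : (forall k, (K <= k)%N -> d k != v) ->
  finite_degeneracy (ndiag d) (v%:R).
Proof.
move=> dv; exists K, (fun i => e_ R i) => x xE; exists (fun i => x i).
transitivity (l2trunc x K).
  apply/l2P => k; rewrite l2truncE; case: ltnP => // /dv dk; apply/eqP.
  have /eqP : v%:R * x k = (d k)%:R * x k := xE k.
  by rewrite -subr_eq0 -mulrBl mulf_eq0 subr_eq0 eqr_nat eq_sym (negPf dk).
elim: K {dv} => [|K IHK]; first by rewrite big_ord0 l2trunc0.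
by rewrite big_ord_recr /= l2truncS addrC IHK.
Qed.

Lemma ndiag_self_adjoint d : self_adjoint (ndiag d).
Proof. by apply: diag_self_adjoint => k; exact: (rmorph_nat (@conjc R)). Qed.

Lemma ndiag_discrete d : (forall v, exists K, forall k, (K <= k)%N -> d k != v) ->
  discrete_spectrum (ndiag d).
Proof.
move=> dv; split; first exact: ndiag_self_adjoint.
move=> z /ndiag_spectrum[k ->]; split; first exact: ndiag_isolated.
by have [K dK] := dv (d k); exact: ndiag_degeneracy dK.
Qed.

Lemma ndiag_discrete_off_kernel d :
  (forall v, v != 0 -> exists K, forall k, (K <= k)%N -> d k != v)%N ->
  discrete_spectrum_off_kernel (ndiag d).
Proof.
move=> dv; split; first exact: ndiag_self_adjoint.
move=> z /ndiag_spectrum[k ->]; split; first exact: ndiag_isolated.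
rewrite pnatr_eq0 => /dv[K dK]; exact: ndiag_degeneracy dK.
Qed.

Lemma ndiag_dom_dom d d' (M : nat) (x : h) :
  (forall k, d k <= M + M * d' k)%N -> op_dom (ndiag d') x -> op_dom (ndiag d) x.
Proof.
move=> dd' /diag_dom d'x; apply/diag_dom.
apply: (@l2_pred_dom _ M%:R _ x _ _ (l2valP x) d'x) => k.
rewrite [normc (_ * _)]Normc.normcM [normc (_ * _)]Normc.normcM !normc_nat mulrA -mulrDl.
by rewrite ler_wpM2r ?normc_ge0 // -natrM -natrD ler_nat.
Qed.

End natural_diagonals.

(** * Comparison of falling factorials with powers *)

Section falling_factorial_bounds.
Implicit Types (k l n m : nat).

Lemma leq_expn2r n m l : (n <= m -> n ^ l <= m ^ l)%N.
Proof. by case: l => // l nm; rewrite leq_exp2r. Qed.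

Lemma ffact_le_expn n l : (n ^_ l <= n ^ l)%N.
Proof.
elim: l n => [|l IHl] n //; rewrite ffactnS expnS leq_mul2l.
by apply/orP; right; exact: leq_trans (IHl _) (leq_expn2r _ (leq_pred _)).
Qed.

Lemma expn_le_ffactD k l : (k ^ l <= (k + l) ^_ l)%N.
Proof.
elim: l => [|l IHl] //; rewrite addnS ffactnS /= expnS leq_mul //.
by rewrite -addnS leq_addr.
Qed.

Lemma ffactD_le_expn k l : (l <= k)%N -> ((k + l) ^_ l <= 2 ^ l * k ^ l)%N.
Proof.
move=> lk; apply: leq_trans (ffact_le_expn _ _) _; rewrite -expnMn.
by rewrite leq_expn2r // mul2n -addnn leq_add2l.
Qed.

(** For [2 l < j] one has [j <= 2 (j - l)], and [(j - l)^l] is at most [j ^_ l]. The additive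
    constant takes care of [j <= 2 l], in particular of [j < l], where [j ^_ l] may vanish. *)
Lemma expn_le_ffact j l : (j ^ l <= (2 * l) ^ l + 2 ^ l * j ^_ l)%N.
Proof.
have [->|l0] := posnP l; first by rewrite !expn0 ffactn0.
have [jl|lj] := leqP j (2 * l).
  by apply: leq_trans (leq_addr _ _); rewrite leq_exp2r.
have lj' : (l <= j)%N by apply: leq_trans (ltnW lj); rewrite leq_pmull.
apply: leq_trans (leq_addl _ _); rewrite -[in X in (_ <= X)%N](subnK lj').
apply: leq_trans (leq_mul (leqnn _) (expn_le_ffactD _ _)).
rewrite -expnMn leq_exp2r // mulnBr -(leq_add2r (2 * l)) subnK ?leq_mul2l ?lj' ?orbT //.
by rewrite [leqRHS]mul2n -addnn leq_add2l ltnW.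
Qed.

(** Deliberately coarse: with the constants of [expn_le_ffact], one number serves in several domain
    comparisons. *)
Lemma ffact_le_exp_bound j l : (j ^_ l <= (2 * l) ^ l + 2 ^ l * j ^ l)%N.
Proof.
apply: leq_trans (ffact_le_expn _ _) _; apply: leq_trans (leq_addl _ _).
by rewrite leq_pmull // expn_gt0.
Qed.

Lemma ffactD_le_exp_bound k l : ((k + l) ^_ l <= (2 * l) ^ l + 2 ^ l * k ^ l)%N.
Proof.
have [/ffactD_le_expn kl|kl] := leqP l k; first exact: leq_trans kl (leq_addl _ _).
apply: leq_trans (ffact_le_expn _ _) (leq_trans _ (leq_addr _ _)).
by rewrite leq_expn2r // mul2n -addnn leq_add2r ltnW.
Qed.

(** This makes the nonzero entries of the diagonal operators grow, so that no nonzero value recurs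
    infinitely often. *)
Lemma ltn_ffactD k l : (0 < l)%N -> (k < (k + l) ^_ l)%N.
Proof.
case: l => // l _; elim: l k => [|l IHl] k; first by rewrite addn1 ffactn1.
rewrite addnS ffactnS /=; apply: leq_trans (IHl k) _.
by rewrite leq_pmull // addnS.
Qed.

(** A mean value estimate for the [n]-th power on an interval of length [d], with the derivative
    bounded by its value at the right end. *)
Lemma expnD_le b d n : ((b + d) ^ n <= b ^ n + n * d * (b + d) ^ n.-1)%N.
Proof.
elim: n => [|[|n] IHn]; [by []|by rewrite !expn1 mul1n expn0 muln1|].
rewrite [leqLHS]expnS mulnDl.
apply: leq_trans (_ : b * (b ^ n.+1 + n.+1 * d * (b + d) ^ n)
  + d * (b + d) ^ n.+1 <= _)%N; first by rewrite leq_add2r leq_mul2l IHn orbT.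
rewrite mulnDr -expnS -addnA leq_add2l /= [X in (_ <= X)%N](_ : _ =
  n.+1 * d * (b + d) ^ n.+1 + d * (b + d) ^ n.+1)%N; last by rewrite -!mulnDl -mulSnr.
rewrite leq_add2r mulnCA leq_mul2l; apply/orP; right.
by rewrite expnS leq_mul2r leq_addr orbT.
Qed.

(* [(k+l)...(k+1)] and [k...(k-l+1)] have the same leading term [k^l]. *)
Lemma ffact_difference k l : (l <= k)%N ->
  ((k + l) ^_ l <= k ^_ l + l * (2 * l) * (2 * k) ^ l.-1)%N.
Proof.
move=> lk; apply: leq_trans (ffact_le_expn _ _) _.
have -> : (k + l = (k - l) + 2 * l)%N by rewrite mul2n -addnn addnA subnK.
apply: leq_trans (expnD_le _ _ _) _; apply: leq_add.
  by have := expn_le_ffactD (k - l) l; rewrite subnK.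
rewrite leq_mul2l; apply/orP; right; apply: leq_expn2r.
by rewrite !mul2n -!addnn addnA subnK // leq_add2l.
Qed.

End falling_factorial_bounds.

(** * Powers of the annihilation operator and the domain of [N^(l/2)] *)

Section lowering.
Variable R : realType.
Local Notation C := R[i].
Local Notation h := (l2 R).
Local Notation l2p := (@l2_pred R).

(** [A^l] sends [e_(k+l)] to this multiple of [e_k]; the radicand is [(k+1)...(k+l)]. *)
Definition lower_coef l k : C := (Num.sqrt ((k + l) ^_ l)%:R)%:C.

Lemma lower_coef_sqr l k : lower_coef l k * lower_coef l k = ((k + l) ^_ l)%:R.
Proof. by rewrite -rmorphM -expr2 sqr_sqrtr ?ler0n // rmorph_nat. Qed.

Lemma lower_coef_conj l k : conjc (lower_coef l k) = lower_coef l k.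
Proof. by rewrite /lower_coef /= oppr0. Qed.

Lemma ffactD_gt0 k l : (0 < (k + l) ^_ l)%N.
Proof. by rewrite ffact_gt0 leq_addl. Qed.

Lemma lower_coef_ge1 l k : 1 <= normc (lower_coef l k).
Proof.
rewrite normc_realC ger0_norm ?sqrtr_ge0 // -[leLHS]sqrtr1 ler_wsqrtr //.
by rewrite ler1n ffactD_gt0.
Qed.

Lemma numop_sqrt : fcalc (fun t => (Num.sqrt t)%:C) numop =
  diag (fun k => (Num.sqrt k%:R : R)%:C).
Proof. by rewrite numop_diag fcalc_diag. Qed.

(** The explicit domain condition is automatic: [sqrt N x] is the image [y] moved right by one
    place, as its coordinate 0 is zero. *)
Lemma annihilation_shift :
  annihilation = wshift 1 (fun k => (Num.sqrt k.+1%:R : R)%:C).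
Proof.
apply/seteqP; split=> -[x y] /=; first by move=> [_ yE] k; rewrite (yE k) addn1.
move=> yE; split=> [|k]; last by rewrite (yE k) /= addn1.
rewrite numop_sqrt; apply/diag_dom.
apply: (@l2_pred_le _ 1 _ _ _ (l2_pred_unshift 1 (l2valP y))) => -[|k].
  by rewrite mulr0n sqrtr0 mul0r Normc.normc0 mul1r.
by rewrite mul1r -addn1 unshiftE (yE k) /= addn1.
Qed.

Lemma annihilation_pow l : op_pow annihilation l = wshift l (lower_coef l).
Proof.
elim: l => [|l IHl].
  rewrite /op_pow /op_id /lower_coef; apply/seteqP; split=> -[x y] /=.
    by move=> -> k; rewrite addn0 ffactn0 sqrtr1 mul1r.
  by move=> yE; apply/l2P => k; rewrite (yE k) /= addn0 ffactn0 sqrtr1 mul1r.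
have coefS k : (Num.sqrt k.+1%:R : R)%:C * lower_coef l k.+1 = lower_coef l.+1 k.
  rewrite /lower_coef -rmorphM -sqrtrM ?ler0n // -natrM addSnnS; congr (Num.sqrt _%:R)%:C.
  by rewrite ffactnSr mulnC -addSnnS addnK.
rewrite /op_pow /= -/(op_pow _ _) IHl annihilation_shift.
apply/seteqP; split=> -[x y] /=.
  by move=> [u uE yE] k; rewrite (yE k) /= (uE (k + 1)%N) /= addn1 addSnnS mulrA coefS.
move=> yE; have ul2 : (fun k => lower_coef l k * x (k + l)%N) \in l2p.
  (* [A^(l+1) x] controls [A^l x] except at coordinate 0, which [A] annihilates; that coordinate is
     bounded through [x] itself. *)
  pose M := 1 + normc (lower_coef l 0).
  have M1 : 1 <= M by rewrite lerDl normc_ge0.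
  have M0 : 0 <= M by exact: le_trans M1.
  apply: (@l2_pred_dom _ M _ (unshift 1 y) (fun k => x (k + l)%N)).
  - case=> [|k].
      rewrite -[leLHS]add0r lerD ?mulr_ge0 ?normc_ge0 // Normc.normcM.
      by rewrite ler_wpM2r ?normc_ge0 // lerDr.
    rewrite -addn1 unshiftE (yE k) -coefS addn1 -mulrA addSnnS.
    rewrite -[leLHS]addr0 lerD ?mulr_ge0 ?normc_ge0 //.
    rewrite -[leLHS]mul1r ler_pM ?normc_ge0 //.
    rewrite [leRHS]Normc.normcM ler_peMl ?normc_ge0 // normc_realC ger0_norm ?sqrtr_ge0 //.
    by rewrite -[leLHS]sqrtr1 ler_wsqrtr // ler1n.
  - exact/l2_pred_unshift/l2valP.
  - exact/l2_pred_shift/l2valP.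
by exists (L2 ul2) => //= k; rewrite (yE k) /= addn1 -coefS -mulrA addSnnS.
Qed.

Lemma powR_half (x : R) l : 0 <= x -> x `^ (l%:R / 2) = Num.sqrt (x ^+ l).
Proof.
move=> x0; rewrite mulrC powRrM powR12_sqrt // powR_mulrn ?sqrtr_ge0 //.
elim: l => [|l IHl]; first by rewrite !expr0 sqrtr1.
by rewrite !exprS sqrtrM // IHl.
Qed.

(** The constant survives the square root because [M <= M^2] for a natural [M]. *)
Lemma sqrt_nat_le (M a b : nat) : (a <= M + M * b)%N ->
  Num.sqrt a%:R <= M%:R + M%:R * Num.sqrt b%:R :> R.
Proof.
move=> ab; set s := Num.sqrt b%:R.
have s0 : 0 <= s by exact: sqrtr_ge0.
have t0 : 0 <= M%:R + M%:R * s by rewrite addr_ge0 ?mulr_ge0.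
rewrite -[leRHS](ger0_norm t0) -sqrtr_sqr ler_wsqrtr //.
apply: le_trans (_ : (M + M * b)%:R <= _); first by rewrite ler_nat.
have MM : M%:R <= M%:R ^+ 2 :> R.
  by rewrite -natrX ler_nat expnS expn1; case: (M) => // n; rewrite leq_pmulr.
have bs : b%:R = s ^+ 2 by rewrite sqr_sqrtr.
rewrite natrD natrM bs sqrrD exprMn -addrA lerD // -[leLHS]add0r lerD //.
  by rewrite mulrn_wge0 // !mulr_ge0.
by rewrite ler_wpM2r ?sqr_ge0.
Qed.

(** The squared weights [j^l] and [j ^_ l] bound each other up to constants; the additive constant
    in one direction is absorbed by [x]. *)
Lemma dom_numpow l :
  op_dom (numpow (l%:R / 2 : R)) = op_dom (wshift l (lower_coef l)).
Proof.
rewrite /numpow numop_diag fcalc_diag.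
apply/seteqP; split=> x.
  move/diag_dom => xN; apply/wshift_dom.
  apply: (@l2_pred_le _ 1 _ _ _ (l2_pred_shift l xN)) => k.
  rewrite mul1r !Normc.normcM ler_wpM2r ?normc_ge0 // !normc_realC.
  rewrite powR_half // !ger0_norm ?sqrtr_ge0 // ler_wsqrtr // -natrX ler_nat.
  exact: ffact_le_expn.
move/wshift_dom => xN; apply/diag_dom.
pose M := ((2 * l) ^ l + 2 ^ l)%N.
apply: (@l2_pred_dom _ M%:R _ x _ _ (l2valP x) (l2_pred_unshift l xN)) => j.
have -> : unshift l (fun k => lower_coef l k * x (k + l)%N) j =
    (Num.sqrt (j ^_ l)%:R)%:C * x j.
  rewrite /unshift /lower_coef; case: ltnP => lj; last by rewrite subnK.
  by rewrite ffact_small // sqrtr0 mul0r.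
rewrite [normc (_ * _)]Normc.normcM [normc (_%:C * _)]Normc.normcM !normc_realC.
rewrite powR_half // !ger0_norm ?sqrtr_ge0 //.
rewrite mulrA -mulrDl ler_wpM2r ?normc_ge0 // -natrX; apply: sqrt_nat_le.
apply: leq_trans (expn_le_ffact _ _) _; rewrite leq_add ?leq_addr //.
by rewrite leq_mul2r leq_addl orbT.
Qed.

(** With nonzero weights of modulus at least 1, [|a_k x_k|] is at most [|a_k^2 x_k|], so the
    intermediate vector exists whenever the final one does. *)
Lemma wshift_bshift l (a : nat -> C) :
  (forall k, a k != 0 -> 1 <= normc (a k)) ->
  op_comp (wshift l a) (bshift l a) = diag (fun k => a k * a k).
Proof.
move=> a1; apply/seteqP; split=> -[x y] /=.
  by move=> [u uE yE] k; rewrite (yE k) (uE (k + l)%N) unshiftE mulrA.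
move=> yE; have ul2 : unshift l (fun k => a k * x k) \in l2p.
  apply: l2_pred_unshift; apply: (@l2_pred_le _ 1 _ y _ (l2valP y)) => k.
  rewrite mul1r (yE k) /= -mulrA; have [->|/a1 ak] := eqVneq (a k) 0.
    by rewrite !mul0r.
  by rewrite [leRHS]Normc.normcM ler_peMl ?normc_ge0.
exists (L2 ul2) => k //.
rewrite (yE k) -[(L2 ul2, y).1 _]/(unshift l (fun k => a k * x k) (k + l)%N).
by rewrite unshiftE mulrA.
Qed.

Lemma bshift_wshift l (a : nat -> C) :
  (forall k, a k != 0 -> 1 <= normc (a k)) ->
  op_comp (bshift l a) (wshift l a) = diag (unshift l (fun k => a k * a k)).
Proof.
move=> a1; apply/seteqP; split=> -[x y] /=.
  move=> [u uE yE] j; rewrite (yE j) /unshift; case: ltnP => lj; first by rewrite mul0r.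
  by rewrite (uE (j - l)%N) /= subnK // mulrA.
move=> yE; have ul2 : (fun k => a k * x (k + l)%N) \in l2p.
  apply: (@l2_pred_le _ 1 _ _ _ (l2_pred_shift l (l2valP y))) => k.
  rewrite mul1r (yE (k + l)%N) /= unshiftE -mulrA; have [->|/a1 ak] := eqVneq (a k) 0.
    by rewrite !mul0r.
  by rewrite [leRHS]Normc.normcM ler_peMl ?normc_ge0.
exists (L2 ul2) => j //=.
rewrite (yE j) /unshift /=; case: ltnP => lj; first by rewrite mul0r.
by rewrite subnK // mulrA.
Qed.

Lemma rising_diag l : @rising_numop R l = ndiag (fun k => (k + l) ^_ l)%N.
Proof.
rewrite /rising_numop; under eq_bigr do rewrite numop_diag op_add_diag.
rewrite big_op_comp_diag => [|i].
  congr diag; apply/funext => k; elim: l => [|l IHl]; first by rewrite big_geq.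
  rewrite big_nat_recr //= IHl addnS ffactnS /= natrM mulrC rmorph_nat -addnS natrD.
  by [].
exists 1%N => k k1; rewrite rmorph_nat -natrD normc_nat ler1n.
exact: leq_trans k1 (leq_addr _ _).
Qed.

Lemma falling_diag l : @falling_numop R l = ndiag (fun k => k ^_ l)%N.
Proof.
rewrite /falling_numop; under eq_bigr do rewrite numop_diag op_sub_diag.
rewrite big_op_comp_diag => [|i].
  congr diag; apply/funext => k; elim: l => [|l IHl]; first by rewrite big_geq.
  rewrite big_nat_recr //= IHl ffactnSr natrM rmorph_nat.
  (* For [k < l] truncated subtraction differs from the true difference, but its cofactor [k ^_ l]
     is zero. *)
  by have [lk|kl] := leqP l k; [rewrite natrB|rewrite ffact_small // !mul0r].
exists i.+1 => k ik; rewrite rmorph_nat -natrB; last exact: ltnW.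
by rewrite normc_nat ler1n subn_gt0.
Qed.

Lemma op_pow_numop l : op_pow (@numop R) l = ndiag (fun k => k ^ l)%N.
Proof.
rewrite numop_diag (@op_pow_diag _ _ _ 1) => [|k k1].
  by congr diag; apply/funext => k; rewrite natrX rmorph_nat.
by rewrite rmorph_nat normc_nat ler1n.
Qed.

End lowering.

(** * The operator [X], with an arbitrary indicator [b] in place of that of [B] *)

Section lowering_operator.
Variables (R : realType) (l : nat) (b : nat -> bool).
Local Notation C := R[i].
Local Notation h := (l2 R).
Local Notation D := (op_dom (numpow (l%:R / 2 : R))).
Local Notation Dl := (op_dom (op_pow (@numop R) l)).

Definition lowering_weight k : C := (b k)%:R * lower_coef R l k.

Definition lowering : set (h * h) := op_res (wshift l lowering_weight) D.

(** Entry at [k] of the diagonal operator [X X^*]: [e_k] is raised to [e_(k+l)] and lowered back. *)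
Definition raise_lower k := (b k * (k + l) ^_ l)%N.

(** Entry at [j] of [X^* X]. For [j < l] the truncated [j - l] is 0, but there [j ^_ l] vanishes. *)
Definition lower_raise j := (b (j - l)%N * j ^_ l)%N.

Lemma lowering_weight_sqr k :
  lowering_weight k * lowering_weight k = (raise_lower k)%:R.
Proof.
rewrite mulrACA lower_coef_sqr -natrM mulnb andbb -natrM //.
Qed.

Lemma lowering_weight_ge1 k : lowering_weight k != 0 -> 1 <= normc (lowering_weight k).
Proof.
rewrite /lowering_weight; case: (b k); last by rewrite mul0r eqxx.
by rewrite mul1r lower_coef_ge1.
Qed.

Lemma lowering_weight_conj k : conjc (lowering_weight k) = lowering_weight k.
Proof. by rewrite conjcM lower_coef_conj (rmorph_nat (@conjc R)). Qed.

Lemma unshift_weight_sqr :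
  unshift l (fun k => lowering_weight k * lowering_weight k) =
  fun j => (lower_raise j)%:R.
Proof.
apply/funext => j; rewrite /unshift /lower_raise; case: ltnP => lj.
  by rewrite ffact_small // muln0.
by rewrite lowering_weight_sqr /raise_lower subnK.
Qed.

Lemma wshift_dom_le (s : nat) (u v : nat -> C) (x : h) :
  (forall k, normc (u k) <= normc (v k)) ->
  op_dom (wshift s v) x -> op_dom (wshift s u) x.
Proof.
move=> uv /wshift_dom vx; apply/wshift_dom; apply: (@l2_pred_le _ 1 _ _ _ vx) => k.
by rewrite mul1r !Normc.normcM ler_wpM2r ?normc_ge0.
Qed.

Lemma lowering_weight_le k : normc (lowering_weight k) <= normc (lower_coef R l k).
Proof.
rewrite Normc.normcM ler_piMl ?normc_ge0 // normc_nat; by case: (b k).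
Qed.

Lemma dom_subset_wshift : D `<=` op_dom (wshift l lowering_weight).
Proof. by rewrite dom_numpow => x; apply: wshift_dom_le; exact: lowering_weight_le. Qed.

Lemma finsupp_dom (x : h) : finsupp x -> D x.
Proof. by move=> xf; rewrite dom_numpow; apply/wshift_dom; exact: finsupp_wshift_l2. Qed.

Lemma loweringE :
  op_res (op_comp (diag (fun k => (b k)%:R)) (op_pow annihilation l)) D = lowering.
Proof.
rewrite annihilation_pow; apply/seteqP; split=> -[x y] /= [xy Dx]; split=> //=.
  by move: xy => [u uE yE] k; rewrite (yE k) /= (uE k) /= mulrA.
have := Dx; rewrite /= dom_numpow => -[u xu]; exists u => // k.
by rewrite /= (xu k) (xy k) mulrA.
Qed.

Lemma dom_lowering : op_dom lowering = D.
Proof.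
apply/seteqP; split=> x; first by move=> [y []].
by move=> Dx; have [y xy] := dom_subset_wshift Dx; exists y.
Qed.

Lemma between_lowering : between_shift l lowering_weight lowering.
Proof. by split=> [p []//|x y xy /finsupp_dom Dx]. Qed.

Lemma closure_lowering : closure lowering = wshift l lowering_weight.
Proof. exact: closure_between between_lowering. Qed.

Lemma conj_lowering_weight : (fun k => (lowering_weight k)^*) = lowering_weight.
Proof. by apply/funext => k; exact: lowering_weight_conj. Qed.

Lemma adjoint_lowering : adjoint lowering = bshift l lowering_weight.
Proof. by rewrite (adjoint_between between_lowering) conj_lowering_weight. Qed.

Lemma adjoint_wshift :
  adjoint (wshift l lowering_weight) = bshift l lowering_weight.
Proof.
rewrite -[in RHS]conj_lowering_weight; apply: adjoint_between.
by split=> // x y.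
Qed.

Lemma rising_diag_proj :
  op_comp (rising_numop l) (diag (fun k => (b k)%:R : C)) = ndiag raise_lower.
Proof.
rewrite rising_diag (@op_comp_diag_ge1 _ _ _ 0) => [|k _].
  by congr diag; apply/funext => k; rewrite /raise_lower mulnC natrM.
by rewrite normc_nat ler1n ffactD_gt0.
Qed.

(* [q] is arbitrary below [l], where the falling factorial vanishes. *)
Lemma falling_diag_proj (q : nat -> C) : (forall k, q (k + l)%N = (b k)%:R) ->
  op_comp (falling_numop l) (diag q) = ndiag lower_raise.
Proof.
move=> qb; rewrite falling_diag (@op_comp_diag_ge1 _ _ _ l) => [|k lk].
  congr diag; apply/funext => k; rewrite /lower_raise mulnC natrM.
  have [lk|kl] := leqP l k; last by rewrite ffact_small // !mul0r.
  by rewrite -qb subnK.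
by rewrite normc_nat ler1n ffact_gt0.
Qed.

Lemma wshift_bshift_lowering :
  op_comp (wshift l lowering_weight) (bshift l lowering_weight) = ndiag raise_lower.
Proof.
rewrite wshift_bshift; last exact: lowering_weight_ge1.
by congr diag; apply/funext => k; exact: lowering_weight_sqr.
Qed.

Lemma bshift_wshift_lowering :
  op_comp (bshift l lowering_weight) (wshift l lowering_weight) = ndiag lower_raise.
Proof.
by rewrite bshift_wshift ?unshift_weight_sqr //; exact: lowering_weight_ge1.
Qed.

(** The restriction of [X] to [D] costs nothing here: [X^* x] is supported on the indices [k + l]
    with [b k], where the weights of [X] and [A^l] agree, so it lies in [D] as soon as the shift
    maps it into [l^2]. *)
Lemma lowering_adjoint : op_comp lowering (adjoint lowering) = ndiag raise_lower.
Proof.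
rewrite -wshift_bshift_lowering adjoint_lowering.
apply/seteqP; split=> -[x y] /= [u uE yE].
  by exists u => //; case: yE.
exists u => //; split=> //=; rewrite dom_numpow; apply/wshift_dom.
apply: (@l2_pred_le _ 1 _ y _ (l2valP y)) => k; rewrite mul1r (yE k) /= (uE (k + l)%N) unshiftE.
rewrite /lowering_weight; case: (b k); first by rewrite !mul1r.
by rewrite !mul0r mulr0.
Qed.

(** Here [X] acts first, so its domain [D] remains visible in the product. *)
Lemma adjoint_lowering_comp :
  op_comp (adjoint lowering) lowering = op_res (ndiag lower_raise) D.
Proof. by rewrite op_comp_resr adjoint_lowering bshift_wshift_lowering. Qed.

Lemma commutator_lowering :
  commutator_adj lowering =
  op_res (op_sub (ndiag raise_lower) (ndiag lower_raise)) D.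
Proof. by rewrite /commutator_adj lowering_adjoint adjoint_lowering_comp op_sub_resr. Qed.

Lemma commutator_closure :
  commutator_adj (wshift l lowering_weight) =
  op_sub (ndiag raise_lower) (ndiag lower_raise).
Proof.
by rewrite /commutator_adj adjoint_wshift wshift_bshift_lowering bshift_wshift_lowering.
Qed.

Lemma raise_lower_le k : (raise_lower k <= (k + l) ^_ l)%N.
Proof. by rewrite /raise_lower; case: (b k); rewrite ?mul1n ?mul0n. Qed.

Lemma lower_raise_le k : (lower_raise k <= k ^_ l)%N.
Proof. by rewrite /lower_raise; case: (b _); rewrite ?mul1n ?mul0n. Qed.

Let M := ((2 * l) ^ l + 2 ^ l)%N.

Let bound_M n k : (n <= (2 * l) ^ l + 2 ^ l * k -> n <= M + M * k)%N.
Proof.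
move/leq_trans; apply; rewrite leq_add ?leq_addr //.
by rewrite leq_mul2r leq_addl orbT.
Qed.

Lemma pow_dom_raise_lower : Dl `<=` op_dom (ndiag raise_lower).
Proof.
rewrite op_pow_numop => x; apply: (@ndiag_dom_dom _ _ _ M) => k.
apply: leq_trans (raise_lower_le _) _; exact/bound_M/ffactD_le_exp_bound.
Qed.

Lemma pow_dom_lower_raise : Dl `<=` op_dom (ndiag lower_raise).
Proof.
rewrite op_pow_numop => x; apply: (@ndiag_dom_dom _ _ _ M) => k.
apply: leq_trans (lower_raise_le _) _; exact/bound_M/ffact_le_exp_bound.
Qed.

Lemma pow_dom_half : Dl `<=` D.
Proof.
rewrite op_pow_numop dom_numpow => x /diag_dom xN; apply/wshift_dom.
apply: (@l2_pred_le _ 1 _ _ _ (l2_pred_shift l xN)) => k.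
rewrite mul1r !Normc.normcM ler_wpM2r ?normc_ge0 // normc_realC ger0_norm ?sqrtr_ge0 //.
rewrite normc_nat -[leRHS](ger0_norm (ler0n _ _)) -sqrtr_sqr ler_wsqrtr //.
rewrite -natrX ler_nat; apply: leq_trans (ffact_le_expn _ _) _.
by rewrite expnS expn1; case: ((k + l) ^ l)%N => // n; rewrite leq_pmulr.
Qed.

Lemma finsupp_pow_dom (x : h) : finsupp x -> Dl x.
Proof. by move=> xf; rewrite op_pow_numop; apply/diag_dom; exact: finsupp_mul_l2. Qed.

Lemma lower_raise_addn k : lower_raise (k + l) = raise_lower k.
Proof. by rewrite /lower_raise /raise_lower addnK. Qed.

Section cofinite.
Variable K : nat.
Hypothesis bK : forall k, (K <= k)%N -> b k.

Lemma cofinite_lowering : lowering = wshift l lowering_weight.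
Proof.
apply: op_res_id => x /wshift_dom xl; rewrite dom_numpow; apply/wshift_dom.
(* From index [K] on, the weights of [X] and [A^l] agree; the truncation covers the coordinates that
   enter below [K]. *)
pose y := l2trunc x (K + l)%N.
apply: (@l2_pred_dom _ 1 _ _ _ _ xl (finsupp_wshift_l2 l (lower_coef R l)
  (finsupp_trunc x (K + l)%N))) => k.
rewrite !mul1r l2truncE ltn_add2r; case: ltnP => Kk.
  by rewrite -[leLHS]add0r lerD ?normc_ge0.
by rewrite /lowering_weight bK // mul1r -[leLHS]addr0 lerD ?normc_ge0.
Qed.

(** [(K + l)^l] bounds [k^l] below [K + l], where [b] gives no information; the other terms are the
    constants of [expn_le_ffact]. *)
Let MK := (2 ^ l + (2 * l) ^ l + (K + l) ^ l)%N.

Lemma cofinite_pow_dom_raise_lower : op_dom (ndiag raise_lower) `<=` Dl.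
Proof.
rewrite op_pow_numop => x; apply: (@ndiag_dom_dom _ _ _ MK) => k.
have [Kk|kK] := leqP K k.
  rewrite /raise_lower bK // mul1n; apply: leq_trans (leq_addl _ _).
  apply: leq_trans (expn_le_ffactD _ _) _; rewrite leq_pmull //.
  by rewrite /MK -addnA ltn_addr // expn_gt0.
apply: leq_trans (leq_addr _ _); apply: leq_trans (leq_addl _ _).
by apply: leq_expn2r; rewrite ltnW // ltn_addr.
Qed.

Lemma cofinite_pow_dom_lower_raise : op_dom (ndiag lower_raise) `<=` Dl.
Proof.
rewrite op_pow_numop => x; apply: (@ndiag_dom_dom _ _ _ MK) => k.
have [Kk|kK] := leqP (K + l) k.
  rewrite /lower_raise bK ?leq_subRL ?mul1n //; last first.
    exact: leq_trans (leq_addl _ _) Kk.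
    by rewrite addnC.
  apply: leq_trans (expn_le_ffact _ _) _.
  rewrite leq_add //; first by rewrite /MK -addnA addnCA leq_addr.
  by rewrite leq_mul2r /MK -addnA leq_addr orbT.
apply: leq_trans (leq_addr _ _); apply: leq_trans (leq_addl _ _).
by apply: leq_expn2r; rewrite ltnW.
Qed.

End cofinite.

Section positive_shift.
Hypothesis l_gt0 : (0 < l)%N.

Lemma raise_lower_gt k : b k -> (k < raise_lower k)%N.
Proof. by rewrite /raise_lower => ->; rewrite mul1n ltn_ffactD. Qed.

Lemma raise_lower_tends v : v != 0%N ->
  exists K, forall k, (K <= k)%N -> raise_lower k != v.
Proof.
move=> v0; exists v => k vk; case bk: (b k); last first.
  by rewrite /raise_lower bk mul0n eq_sym.
by rewrite gtn_eqF // (leq_ltn_trans vk) // raise_lower_gt.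
Qed.

Lemma tends_addn (d : nat -> nat) v :
  (exists K, forall k, (K <= k)%N -> d (k + l)%N != v) ->
  exists K, forall k, (K <= k)%N -> d k != v.
Proof.
move=> [K dK]; exists (K + l)%N => k Kk.
have lk : (l <= k)%N by exact: leq_trans (leq_addl _ _) Kk.
by rewrite -(subnK lk); apply: dK; rewrite leq_subRL // addnC.
Qed.

Lemma lower_raise_tends v : v != 0%N ->
  exists K, forall k, (K <= k)%N -> lower_raise k != v.
Proof.
move=> /raise_lower_tends[K rK]; apply: tends_addn; exists K => k /rK.
by rewrite lower_raise_addn.
Qed.

Lemma cofinite_raise_lower_tends K v : (forall k, (K <= k)%N -> b k) ->
  exists K, forall k, (K <= k)%N -> raise_lower k != v.
Proof.
move=> bK; exists (maxn K v) => k; rewrite geq_max => /andP[/bK bk vk].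
by rewrite gtn_eqF // (leq_ltn_trans vk) // raise_lower_gt.
Qed.

Lemma cofinite_lower_raise_tends K v : (forall k, (K <= k)%N -> b k) ->
  exists K, forall k, (K <= k)%N -> lower_raise k != v.
Proof.
move=> /cofinite_raise_lower_tends - /(_ v)[K' rK]; apply: tends_addn; exists K' => k /rK.
by rewrite lower_raise_addn.
Qed.

End positive_shift.

Lemma closure_ndiag_res (d : nat -> nat) (E : set h) :
  (forall x, finsupp x -> E x) -> closure (op_res (ndiag d) E) = ndiag d.
Proof.
move=> finE; rewrite /ndiag -wshift0; apply: closure_between.
by split=> [p []//|x y xy /finE].
Qed.

Lemma ndiag_unbounded (d : nat -> nat) (E : set h) :
  (forall x, finsupp x -> E x) -> (forall n, exists k, (n < d k)%N) ->
  ~ op_bounded (op_res (ndiag d) E).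
Proof.
move=> finE dn [m dm]; have [k mk] := dn (Num.truncn m).+1.
have := dm _ _ (conj (diag_e (fun k => (d k)%:R) k) (finE _ (finsupp_e R k))).
rewrite -[`|_ *: _|]/((l2norm _)%:C) -[`|e_ R k|]/((l2norm _)%:C) -rmorphM lecR.
rewrite l2normZr normc_nat l2norm_e !mulr1 => dkm.
have := lt_le_trans (truncnS_gt m) (_ : (Num.truncn m).+1%:R <= (d k)%:R :> R).
by rewrite ler_nat => /(_ (ltnW mk)); rewrite ltNge dkm.
Qed.

End lowering_operator.

(** * Infinitesimal smallness of the commutator *)

Section infinitesimally_small_commutator.
Variables (R : realType).
Local Notation C := R[i].
Local Notation h := (l2 R).

Lemma l2norm_sqrE (x : h) : (l2norm x ^+ 2)%:E = sqsum (fun k => normc (x k)).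
Proof. by rewrite -sqsum_nrm2 ?l2_fin. Qed.

Lemma l2norm_sqr_comb (e c : R) (x u v : h) : 0 <= e -> 0 <= c ->
  (forall k, normc (u k) ^+ 2 <= e * normc (v k) ^+ 2 + c * normc (x k) ^+ 2) ->
  l2norm u ^+ 2 <= e * l2norm v ^+ 2 + c * l2norm x ^+ 2.
Proof.
move=> e0 c0 H; rewrite -lee_fin EFinD (EFinM e) (EFinM c) !l2norm_sqrE.
have ge0 (y : h) k : (0 <= (normc (y k) ^+ 2)%:E)%E by rewrite lee_fin sqr_ge0.
rewrite /sqsum -!nneseriesZl; try by move=> k _; exact: ge0.
rewrite -nneseriesD.
- apply: lee_nneseries => k *; first exact: ge0.
  by rewrite -!EFinM -EFinD lee_fin H.
- by move=> k _ _; rewrite mule_ge0 ?lee_fin ?sqr_ge0.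
- by move=> k _ _; rewrite mule_ge0 ?lee_fin ?sqr_ge0.
Qed.

Lemma infinitesimally_small_diag (S T : set (h * h)) (d : nat -> C) (w : nat -> C) :
  op_dom T `<=` op_dom S -> S `<=` diag d -> T `<=` diag w ->
  (forall e : R, 0 < e -> exists K, forall k, (K <= k)%N ->
    normc (d k) ^+ 2 <= e * normc (w k) ^+ 2) ->
  infinitesimally_small S T.
Proof.
move=> domTS Sd Tw small; split=> //.
apply/eqP; rewrite eq_le; apply/andP; split; last first.
  by apply/ereal_infP => _ [e [e0 _] <-]; rewrite lee_fin ltW.
apply/lee_addgt0Pr => e e0; rewrite add0e; apply: ereal_inf_lbound.
exists e => //; split=> //; have [K dK] := small _ e0.
have c0 : 0 <= \sum_(i < K) normc (d i) ^+ 2 by rewrite sumr_ge0 // => i _; exact: sqr_ge0.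
(* Beyond [K] the [e] term suffices; each of the finitely many other entries of [d] is dominated by
   this sum. *)
exists (\sum_(i < K) normc (d i) ^+ 2) => // x u v /Sd xu /Tw xv.
rewrite -[`|u|]/((l2norm _)%:C) -[`|v|]/((l2norm _)%:C) -[`|x|]/((l2norm _)%:C).
rewrite -!rmorphXn -!rmorphM -rmorphD lecR; apply: l2norm_sqr_comb => // [|k].
  exact: ltW.
rewrite (xu k) (xv k) /= [normc (d k * _)]Normc.normcM [normc (w k * _)]Normc.normcM.
rewrite !exprMn (mulrA e) -mulrDl ler_wpM2r ?sqr_ge0 //.
have [Kk|kK] := leqP K k; first by rewrite -[leLHS]addr0 lerD ?dK.
rewrite -[leLHS]add0r lerD ?(mulr_ge0 (ltW e0)) ?sqr_ge0 //.
by rewrite (bigD1 (Ordinal kK)) //= lerDl sumr_ge0 // => i _; exact: sqr_ge0.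
Qed.

Lemma commutator_small (l : nat) (b : nat -> bool) K :
  (forall k, (K <= k)%N -> b k = b (k - l)%N) -> (l <= K)%N ->
  infinitesimally_small
    (op_res (commutator_adj (@lowering R l b)) (op_dom (op_pow numop l)))
    (op_pow numop l).
Proof.
move=> bK lK; have subD : op_sub (ndiag (raise_lower l b)) (ndiag (lower_raise l b)) `<=`
    diag (fun k => (raise_lower l b k)%:R - (lower_raise l b k)%:R : C).
  move=> [x y] [u [v [xu [w xw /= vw] yE]]] k; rewrite /= in yE.
  by rewrite yE coordD vw coordZ (xu k) (xw k) /= mulN1r mulrBl.
rewrite commutator_lowering.
apply: (@infinitesimally_small_diag _ _
  (fun k => (raise_lower l b k)%:R - (lower_raise l b k)%:R) (fun k => (k ^ l)%:R)).
- move=> x xN; have [u xu] := pow_dom_raise_lower b xN.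
  have [v xv] := pow_dom_lower_raise b xN.
  exists (u + -1 *: v); do 2 ?[split=> //]; last exact: pow_dom_half.
  by exists u, (-1 *: v); split=> //; exists v.
- by move=> p [[/subD]].
- by rewrite op_pow_numop.
(* [c] is the constant of [ffact_difference] with the power of 2 taken out of [(2 k)^(l-1)]. *)
move=> e e0; pose c := (l * (2 * l) * 2 ^ l.-1)%N.
(* For [k] beyond this, [c^2 <= e k <= e k^2], which turns the bound [c k^(l-1)] into a small
   multiple of [k^l]. *)
pose K' := (Num.truncn (c%:R ^+ 2 / e)).+1.
exists (maxn K K') => k; rewrite geq_max => /andP[Kk K'k].
have lk : (l <= k)%N by exact: leq_trans Kk.
have k0 : (0 < k)%N by exact: leq_trans K'k.
have ck : normc ((raise_lower l b k)%:R - (lower_raise l b k)%:R : C) <=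
    (c * k ^ l.-1)%:R.
  rewrite /raise_lower /lower_raise -bK //; case: (b k); last first.
    by rewrite !mul0n subrr Normc.normc0 ler0n.
  rewrite !mul1n -natrB; last exact: (leq_trans (ffact_le_expn _ _) (expn_le_ffactD _ _)).
  rewrite normc_nat ler_nat leq_subLR /c -mulnA -expnMn.
  exact: ffact_difference.
apply: le_trans (_ : (c * k ^ l.-1)%:R ^+ 2 <= _).
  by rewrite ler_pXn2r ?nnegrE ?normc_ge0.
rewrite normc_nat; have [l0|l0] := posnP l.
  by rewrite /c l0 !mul0n expr0n /= (mulr_ge0 (ltW e0)) ?sqr_ge0.
have -> : (k ^ l = k * k ^ l.-1)%N by rewrite -expnS prednK.
rewrite (natrM _ c) (natrM _ k) !exprMn (mulrA e) ler_wpM2r ?sqr_ge0 //.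
rewrite [leRHS]mulrC -ler_pdivrMr //.
apply: le_trans (_ : K'%:R <= _); first exact: ltW (truncnS_gt _).
by rewrite -natrX ler_nat (leq_trans K'k) // expnS expn1 leq_pmulr.
Qed.

End infinitesimally_small_commutator.

(** * Weighted shifts as Hilbert-Schmidt operators *)

Section shift_hilbert_schmidt.
Variable R : realType.
Local Notation C := R[i].
Local Notation h := (l2 R).
Local Notation l2p := (@l2_pred R).
Implicit Types (a x y : h) (s : nat).

Lemma bounded_linear_l2_continuous (T : h -> h) (M : R) : linear T ->
  (forall x, l2norm (T x) <= M * l2norm x) -> continuous T.
Proof.
move=> Tl TM x U /nbhs_normP[e e0 eU]; have [r r0 eE] := ltc_normP e0.
have M0 : 0 < 1 + `|M| by rewrite ltr_pwDl.
apply/nbhs_normP; exists (r / (1 + `|M|))%:C => [|t]; first by rewrite /= ltcR divr_gt0.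
change ((l2norm (x - t))%:C < (r / (1 + `|M|))%:C -> U (T t)).
rewrite ltcR => xt; apply: eU.
change ((l2norm (T x - T t))%:C < e); rewrite eE ltcR.
have -> : T x - T t = T (x - t).
  have := Tl (-1) t x; rewrite !scaleN1r addrC => <-; congr T.
  by rewrite addrC.
apply: le_lt_trans (TM _) _; apply: le_lt_trans (_ : (1 + `|M|) * l2norm (x - t) < _).
  by rewrite ler_wpM2r ?l2norm_ge0 // (le_trans (ler_norm M)) // lerDr.
by rewrite mulrC -ltr_pdivlMr.
Qed.

Lemma fwd_l2 s a x : (fun k => a k * x (k + s)%N) \in l2p.
Proof. exact: (l2_pred_mul a (L2 (l2_pred_shift s (l2valP x)))). Qed.

(* The sum of the operators [a_k |e_k><e_(k+s)|]; [bwd_fun] is that of their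
   transposes. *)
Definition fwd_fun s a x : h := L2 (fwd_l2 s a x).

Lemma bwd_l2 s a x : unshift s (fun k => a k * x k) \in l2p.
Proof. exact/l2_pred_unshift/l2_pred_mul. Qed.

Definition bwd_fun s a x : h := L2 (bwd_l2 s a x).

Lemma fwd_funE s a x k : fwd_fun s a x k = a k * x (k + s)%N. Proof. by []. Qed.

Lemma bwd_funE s a x : l2val (bwd_fun s a x) = unshift s (fun k => a k * x k).
Proof. by []. Qed.

Lemma l2norm_shift_le s x : l2norm (L2 (l2_pred_shift s (l2valP x))) <= l2norm x.
Proof.
rewrite -(@ler_pXn2r _ 2) ?nnegrE ?l2norm_ge0 // -lee_fin !l2norm_sqrE.
exact: (@sqsum_shift _ s (fun k => normc (x k))).
Qed.

Lemma normc_unshift s (u : nat -> C) :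
  (fun k => normc (unshift s u k)) = unshift s (fun k => normc (u k)).
Proof. by apply/funext => k; rewrite /unshift; case: ifP; rewrite ?Normc.normc0. Qed.

Lemma l2norm_mul_le a x : l2norm (L2 (l2_pred_mul a x)) <= l2norm a * l2norm x.
Proof.
apply: l2norm_le; first exact: l2norm_ge0.
by move=> k; rewrite Normc.normcM ler_wpM2r ?normc_ge0 ?normc_coord.
Qed.

Lemma fwd_fun_e s a j : fwd_fun s a (e_ R j) = unshift s a j *: e_ R (j - s)%N.
Proof.
apply/l2P => k; rewrite fwd_funE coordZ !coord_e /unshift; case: ltnP => [js|sj].
  by rewrite mul0r gtn_eqF ?mulr0 // (leq_trans js) ?leq_addl.
rewrite -(eqn_add2r s k) subnK //; case: eqVneq => [<-|_]; last by rewrite !mulr0.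
by rewrite addnK.
Qed.

Lemma bwd_fun_e s a k : bwd_fun s a (e_ R k) = a k *: e_ R (k + s)%N.
Proof.
apply/l2P => j; rewrite bwd_funE coordZ coord_e /unshift; case: ltnP => [js|sj].
  by rewrite ltn_eqF ?mulr0 // (leq_trans js) ?leq_addl.
rewrite coord_e -(eqn_add2r s) subnK //; case: eqVneq => [->|_]; last by rewrite !mulr0.
by rewrite addnK.
Qed.

Lemma sqsum_fwd s a :
  sqsum (fun k => l2norm (fwd_fun s a (e_ R k))) = sqsum (fun k => normc (a k)).
Proof.
rewrite -[RHS](sqsum_unshift s) -normc_unshift; congr sqsum; apply/funext => k.
by rewrite fwd_fun_e l2normZr l2norm_e mulr1.
Qed.

Lemma fwd_hs s a : fwd_fun s a \in @hs_pred R.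
Proof.
have fl : linear (fwd_fun s a).
  move=> c x y; apply/l2P => k; rewrite coordD coordZ !fwd_funE coordD coordZ.
  by rewrite mulrDr mulrCA.
apply/hs_predP; split=> //; last by rewrite sqsum_fwd; exact: l2_fin.
apply: (@bounded_linear_l2_continuous _ (l2norm a)) => // x.
apply: le_trans (l2norm_mul_le a (L2 (l2_pred_shift s (l2valP x)))) _.
by rewrite ler_wpM2l ?l2norm_ge0 // l2norm_shift_le.
Qed.

Definition fwd s a : hs R := HS (fwd_hs s a).

Lemma bwd_hs s a : bwd_fun s a \in @hs_pred R.
Proof.
have fl : linear (bwd_fun s a).
  move=> c x y; apply/l2P => k; rewrite coordD coordZ !bwd_funE /unshift.
  by case: ifP => _; rewrite ?mulr0 ?addr0 // coordD coordZ mulrDr mulrCA.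
apply/hs_predP; split=> //.
  apply: (@bounded_linear_l2_continuous _ (l2norm a)) => // x.
  apply: le_trans (l2norm_mul_le a x).
  rewrite -(@ler_pXn2r _ 2) ?nnegrE ?l2norm_ge0 // -lee_fin !l2norm_sqrE.
  by rewrite -[leRHS](sqsum_unshift s) -normc_unshift lexx.
have -> : (fun k => l2norm (bwd_fun s a (e_ R k))) = fun k => normc (a k).
  by apply/funext => k; rewrite bwd_fun_e l2normZr l2norm_e mulr1.
exact: l2_fin.
Qed.

Definition bwd s a : hs R := HS (bwd_hs s a).

Lemma hsP (S T : hs R) : S = T <-> forall x, S x = T x.
Proof. by split=> [->//|ST]; apply/val_inj/funext. Qed.

Lemma fwdE s a x k : fwd s a x k = a k * x (k + s)%N. Proof. by []. Qed.

Lemma fwdB s a b : fwd s a - fwd s b = fwd s (a - b).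
Proof.
apply/hsP => x; apply/l2P => k.
by rewrite -[LHS]/(fwd s a x k - fwd s b x k) !fwdE coordB mulrBl.
Qed.

Lemma fwdD s a b : fwd s a + fwd s b = fwd s (a + b).
Proof.
apply/hsP => x; apply/l2P => k.
by rewrite -[LHS]/(fwd s a x k + fwd s b x k) !fwdE coordD mulrDl.
Qed.

Lemma fwdZ s (c : C) a : c *: fwd s a = fwd s (c *: a).
Proof.
apply/hsP => x; apply/l2P => k.
by rewrite -[LHS]/(c * fwd s a x k) !fwdE coordZ mulrA.
Qed.

(** So [fwd s] embeds [h] isometrically as one off-diagonal of [L^2(h)], and approximation there
    reduces to truncation of sequences. *)
Lemma hsnorm_fwd s a : hsnorm (fwd s a) = l2norm a.
Proof. by rewrite /hsnorm /nrm2 sqsum_fwd. Qed.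

Lemma fwd_neq0 s a k : a k != 0 -> fwd s a != 0.
Proof.
move=> ak; apply/eqP => /(congr1 (fun T : hs R => T (e_ R (k + s)%N) k)).
by rewrite fwdE coord_e eqxx mulr1 => /eqP; rewrite -[_ == _]/(a k == 0) (negPf ak).
Qed.

Lemma conj_l2 a : (fun k => conjc (a k)) \in l2p.
Proof.
apply: (@l2_pred_le _ 1 _ a _ (l2valP a)) => k; rewrite mul1r.
by case: (a k) => r i /=; rewrite sqrrN.
Qed.

Definition l2conj a : h := L2 (conj_l2 a).

Lemma l2conjE a k : l2conj a k = conjc (a k). Proof. by []. Qed.

Lemma fwd_adjoint s a : hs_adjoint (fwd s a) (bwd s (l2conj a)).
Proof.
move=> x y; rewrite /ip -[RHS](@csum_shift _ s) => [|j js].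
  congr csum; apply/funext => k; rewrite fwdE.
  rewrite -[bwd _ _ _ _]/(unshift s (fun k => l2conj a k * y k) (k + s)%N) unshiftE.
  by rewrite l2conjE !conjcE conjcM mulrCA mulrA.
by rewrite -[bwd _ _ _ _]/(unshift s (fun k => l2conj a k * y k) j) /unshift js mulr0.
Qed.

Lemma bwd_adjoint s a : hs_adjoint (bwd s a) (fwd s (l2conj a)).
Proof.
move=> x y; rewrite /ip -[LHS](@csum_shift _ s) => [|j js].
  congr csum; apply/funext => k; rewrite fwdE.
  rewrite -[bwd _ _ _ _]/(unshift s (fun k => a k * x k) (k + s)%N) unshiftE.
  by rewrite l2conjE !conjcE conjcM mulrCA mulrA.
rewrite -[bwd _ _ _ _]/(unshift s (fun k => a k * x k) j) /unshift js.
by rewrite conjcE /= oppr0 mul0r.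
Qed.

End shift_hilbert_schmidt.

(** * Eigenvectors of the Araki Hamiltonian *)

Section araki_hamiltonian.
Variables (R : realType) (beta : R) (g : R -> R).
Hypothesis beta_gt0 : 0 < beta.
Local Notation C := R[i].
Local Notation h := (l2 R).
Local Notation gN := (left_op (fcalc (fun t => (g t)%:C) numop)).
Implicit Types (a : h) (s : nat).

Lemma fcalc_numop (F : R -> C) : fcalc F numop = diag (fun k => F k%:R).
Proof. by rewrite numop_diag fcalc_diag. Qed.

(** Left multiplication by [g(N)] scales weight [k] by [g(k)], while [j(g(N))] is right
    multiplication and scales it by [g(k+s)]. Finite support puts the operator in both domains,
    whatever the growth of [g]. *)
Lemma liouvillian_finsupp s a : finsupp a ->
  exists2 u : h, op_sub gN (j_op gN) (fwd s a, fwd s u) &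
    forall k, u k = (g k%:R - g (k + s)%:R)%:C * a k.
Proof.
move=> af; pose al : h := L2 (finsupp_mul_l2 (fun k => (g k%:R)%:C) af).
pose ar : h := L2 (finsupp_mul_l2 (fun k => (g (k + s)%:R)%:C) af).
exists (al - ar); last first.
  by move=> k; rewrite coordB rmorphB mulrBl.
exists (fwd s al), (-1 *: fwd s ar); split=> /=; last 1 first.
- by rewrite fwdZ fwdD scaleN1r.
- by move=> x; rewrite fcalc_numop => k; exact: esym (mulrA _ _ _).
(* The three factors of [J g(N) J]: pass to the adjoint, scale its rows by [g], and take the adjoint
   again. *)
exists (fwd s ar) => //; exists (bwd s (l2conj a)), (bwd s (l2conj ar)).
split=> /=; first exact: fwd_adjoint.
  move=> x; rewrite fcalc_numop => j.
  change (unshift s (fun k => l2conj ar k * x k) j =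
    (g j%:R)%:C * unshift s (fun k => l2conj a k * x k) j); rewrite /unshift.
  case: ltnP => [_|sj]; first by rewrite mulr0.
  rewrite !l2conjE -[ar _]/((g (j - s + s)%:R)%:C * a (j - s)%N) subnK // conjcM.
  by rewrite -mulrA; congr (_ * _); rewrite /= oppr0.
have arK : l2conj (l2conj ar) = ar by apply/l2P => k; rewrite !l2conjE conjcK.
by rewrite -[X in hs_adjoint _ (fwd s X)]arK; exact: bwd_adjoint.
Qed.

(** The closure matters: for unbounded [g] the operator [fwd s a] may lie outside the domains of
    [g(N)] and [j(g(N))]. Its truncations lie in both, and on them the difference already acts as a
    scalar. *)
Lemma araki_fwd s a (c : R) :
  (forall k, a k != 0 -> beta * (g (k + s)%:R - g k%:R) = c) ->
  araki beta g (fwd s a, c%:C *: fwd s a).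
Proof.
(* The scalar by which [g(N) - j(g(N))] acts, so that [- beta * kappa = c]. *)
move=> ac; pose kappa : C := (- (c / beta))%:C.
exists (kappa *: fwd s a) => /=; last first.
  rewrite scalerA -rmorphM mulNr mulrN opprK mulrC divfK //.
  exact: lt0r_neq0.
apply/closure_graphP => e e0 /=.
have k0 : 0 < 1 + normc kappa by rewrite ltr_pwDl ?normc_ge0.
have [n0 nP] := @l2trunc_near _ a (e / (1 + normc kappa)) (divr_gt0 e0 k0).
have {}nP := nP n0 (leqnn _).
have [u su uE] := liouvillian_finsupp s (finsupp_trunc a n0).
have {uE} uE : u = kappa *: l2trunc a n0.
  apply/l2P => k; rewrite uE coordZ l2truncE; case: ifP => _; last by rewrite !mulr0.
  have [->|/ac ak] := eqVneq (a k) 0; first by rewrite !mulr0.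
  congr (_ * _); congr (_%:C); rewrite -ak mulrC mulKf ?opprB //.
  exact: lt0r_neq0.
exists (fwd s (l2trunc a n0), fwd s u); split=> //=.
  rewrite fwdB -[`|_|]/((hsnorm _)%:C) hsnorm_fwd ltcR (lt_le_trans nP) //.
  by rewrite ler_pdivrMr // ler_peMr ?(ltW e0) // lerDl normc_ge0.
rewrite fwdZ fwdB -[`|_|]/((hsnorm _)%:C) hsnorm_fwd uE -scalerBr l2normZr ltcR.
apply: le_lt_trans (_ : (1 + normc kappa) * l2norm (a - l2trunc a n0) < _).
  by rewrite ler_wpM2r ?l2norm_ge0 // lerDr.
by rewrite mulrC -ltr_pdivlMr.
Qed.

Lemma araki_eigenvalue j s :
  op_eigenvalue (araki beta g) (beta * (g (j + s)%:R - g j%:R))%:C.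
Proof.
exists (fwd s (e_ R j)); first by apply: (@fwd_neq0 _ _ _ j); rewrite coord_e eqxx oner_eq0.
apply: araki_fwd => k; rewrite coord_e; case: (eqVneq k j) => [->//|_].
by rewrite eqxx.
Qed.

End araki_hamiltonian.

(** * The square root of the Gibbs state and its image under [X] *)

Section gibbs_state.
Variables (R : realType) (beta : R) (g : R -> R) (l : nat) (b : nat -> bool).
Local Notation C := R[i].
Local Notation h := (l2 R).
Local Notation l2p := (@l2_pred R).
Local Notation w := (fun k : nat => expR (- beta * g k%:R)).
Hypothesis moment_fin : (\sum_(0 <= r <oo) (r%:R ^+ l * w r)%:E < +oo)%E.

Lemma moment_l2 : (fun j => (Num.sqrt (j%:R ^+ l * w j))%:C) \in l2p.
Proof.
apply/l2_predP; congr (_ < _)%E : moment_fin; apply: eq_eseriesr => k _.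
by rewrite normc_realC ger0_norm ?sqrtr_ge0 // sqr_sqrtr // mulr_ge0 ?expR_ge0 //.
Qed.

(** [r^l] is at least 1 for [r >= 1], but vanishes at [r = 0] when [l > 0]; the term at 0 is
    therefore charged to [e_0]. *)
Lemma gibbs_l2 : (fun j => (Num.sqrt (w j))%:C) \in l2p.
Proof.
pose M := 1 + Num.sqrt (w 0).
apply: (@l2_pred_dom _ M _ _ (e_ R 0) _ moment_l2 (l2valP _)) => -[|j].
  rewrite coord_e eqxx Normc.normc1 mulr1 !normc_realC !ger0_norm ?sqrtr_ge0 //.
  by rewrite -[leLHS]add0r lerD ?mulr_ge0 ?addr_ge0 ?sqrtr_ge0 // lerDr.
rewrite coord_e Normc.normc0 mulr0 addr0 !normc_realC !ger0_norm ?sqrtr_ge0 //.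
rewrite -[leLHS]mul1r ler_pM ?sqrtr_ge0 // ?lerDl ?sqrtr_ge0 //.
rewrite ler_wsqrtr // ler_peMl ?expR_ge0 // -natrX ler1n expn_gt0 //.
Qed.

Lemma gibbs_sum_cvg : cvgn (series w).
Proof.
have /l2_predP := gibbs_l2; rewrite /sqsum => wfin.
have wE : (\sum_(0 <= k <oo) ((normc (Num.sqrt (w k))%:C) ^+ 2)%:E =
    \sum_(0 <= k <oo) (w k)%:E)%E.
  apply: eq_eseriesr => k _; rewrite normc_realC ger0_norm ?sqrtr_ge0 //.
  by rewrite sqr_sqrtr ?expR_ge0.
rewrite wE in wfin.
have w0 k : (0 <= (w k)%:E)%E by rewrite lee_fin expR_ge0.
apply: nondecreasing_is_cvgn.
  by apply/nondecreasing_seqP => n; rewrite /series /= big_nat_recr //= lerDl expR_ge0.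
exists (fine (\sum_(0 <= k <oo) (w k)%:E)%E) => _ [n _ <-].
rewrite -lee_fin fineK; last first.
  by rewrite ge0_fin_numE // nneseries_ge0.
rewrite /series /= -sumEFin; apply: nneseries_lim_ge => k _ _; exact: w0.
Qed.

Definition partition_fun : R := limn (series w).

Lemma partition_fun_gt0 : 0 < partition_fun.
Proof.
have nd : nondecreasing_seq (series w).
  by apply/nondecreasing_seqP => n; rewrite /series /= big_nat_recr //= lerDl expR_ge0.
apply: lt_le_trans (nondecreasing_cvgn_le nd gibbs_sum_cvg 1%N).
by rewrite /series /= big_nat1 expR_gt0.
Qed.

Lemma csum_real (u : nat -> R) : csum (fun k => (u k)%:C) = (limn (series u))%:C.
Proof.
rewrite /csum /=; congr (_ +i* _).
rewrite (_ : series _ = cst 0) ?lim_cst //.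
by apply/funext => n; rewrite /series /= big1.
Qed.

Lemma op_app_diag (d : nat -> C) k : op_app (diag d) (e_ R k) = d k *: e_ R k.
Proof.
have ex : exists y, diag d (e_ R k, y) by exists (d k *: e_ R k); exact: diag_e.
exact: diag_functional (xgetPex 0 ex) (diag_e d k).
Qed.

Lemma op_scale_diag (z : C) (d : nat -> C) : z != 0 ->
  op_scale z (diag d) = diag (fun k => z * d k).
Proof.
move=> z0; apply/seteqP; split=> -[x y] /=.
  by move=> [u uE /= ->] k; rewrite -mulrA -[_ * x k](uE k).
move=> yE; exists (z^-1 *: y); last by rewrite scalerA divff // scale1r.
by move=> k; rewrite coordZ (yE k) /= -mulrA mulKf.
Qed.

Lemma gibbs_diag : gibbs beta g = diag (fun k => (w k)%:C).
Proof. by rewrite /gibbs fcalc_numop. Qed.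

Lemma trace_gibbs : trace (gibbs beta g) = partition_fun%:C.
Proof.
rewrite /trace /partition_fun -csum_real; congr csum; apply/funext => k.
by rewrite ip_el gibbs_diag op_app_diag coordZ coord_e eqxx mulr1.
Qed.

Lemma rho_sqrt_diag : fcalc (fun t => (Num.sqrt t)%:C) (rho beta g) =
  diag (fun k => (Num.sqrt (partition_fun^-1 * w k))%:C).
Proof.
have Z0 : partition_fun^-1%:C != 0.
  by rewrite fmorph_eq0 invr_eq0 gt_eqF // partition_fun_gt0.
rewrite /rho trace_gibbs -fmorphV gibbs_diag op_scale_diag //.
rewrite -[RHS](@fcalc_diag _ (fun t => (Num.sqrt t)%:C)); congr fcalc; congr diag.
by apply/funext => k; rewrite rmorphM.
Qed.

Let zeta : R := Num.sqrt partition_fun^-1.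

Let sqrt_split k : Num.sqrt (partition_fun^-1 * w k) = zeta * Num.sqrt (w k).
Proof. by rewrite sqrtrM // invr_ge0 ltW // partition_fun_gt0. Qed.

Lemma rho_sqrt_l2 : (fun k => (Num.sqrt (partition_fun^-1 * w k))%:C) \in l2p.
Proof.
apply: (@l2_pred_le _ zeta _ _ _ gibbs_l2) => k.
by rewrite sqrt_split !normc_realC normrM (ger0_norm (sqrtr_ge0 _)).
Qed.

Definition rho_sqrt : h := L2 rho_sqrt_l2.

(** The moment hypothesis is exactly what makes [A^l] applied to the square root of [rho]
    Hilbert-Schmidt, since [(k+l) ^_ l] is at most [(k+l)^l]. *)
Lemma lower_rho_sqrt_l2 :
  (fun k => lower_coef R l k * rho_sqrt (k + l)%N) \in l2p.
Proof.
apply: (@l2_pred_le _ zeta _ _ _ (l2_pred_shift l moment_l2)) => k.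
rewrite -[rho_sqrt _]/((Num.sqrt (partition_fun^-1 * w (k + l)%N))%:C) sqrt_split.
rewrite Normc.normcM !normc_realC !normrM !(ger0_norm (sqrtr_ge0 _)) mulrCA.
rewrite ler_wpM2l ?sqrtr_ge0 // -sqrtrM // ler_wsqrtr // ler_wpM2r ?expR_ge0 //.
by rewrite -natrX ler_nat ffact_le_expn.
Qed.

Lemma lowered_rho_sqrt_l2 :
  (fun k => lowering_weight R l b k * rho_sqrt (k + l)%N) \in l2p.
Proof.
apply: (@l2_pred_le _ 1 _ _ _ lower_rho_sqrt_l2) => k.
rewrite mul1r [leLHS]Normc.normcM [leRHS]Normc.normcM ler_wpM2r ?normc_ge0 //.
exact: lowering_weight_le.
Qed.

Definition lowered_rho_sqrt : h := L2 lowered_rho_sqrt_l2.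

Lemma rho_sqrt_fwd x :
  fcalc (fun t => (Num.sqrt t)%:C) (rho beta g) (x, fwd 0 rho_sqrt x).
Proof. by rewrite rho_sqrt_diag => k; rewrite /= addn0. Qed.

Lemma lowering_rho_sqrt :
  left_op (lowering l b) (fwd 0 rho_sqrt, fwd l lowered_rho_sqrt).
Proof.
move=> x; split=> /=.
  move=> k; change (lowering_weight R l b k * rho_sqrt (k + l)%N * x (k + l)%N =
    lowering_weight R l b k * (rho_sqrt (k + l)%N * x (k + l + 0)%N)).
  by rewrite addn0 mulrA.
rewrite dom_numpow; apply/wshift_dom.
(* Membership in [D(N^(l/2))] is tested with the full weights of [A^l], not with those cut down by
   [b]. *)
have := l2_pred_mul (L2 lower_rho_sqrt_l2) (L2 (l2_pred_shift l (l2valP x))).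
apply: (@l2_pred_le _ 1) => k; rewrite mul1r.
rewrite (_ : _ * _ = lower_coef R l k * rho_sqrt (k + l)%N * x (k + l)%N) //.
by rewrite -[fwd _ _ _ _]/(rho_sqrt (k + l)%N * x (k + l + 0)%N) addn0 mulrA.
Qed.

Lemma rho_sqrt_neq0 k : rho_sqrt k != 0.
Proof.
rewrite -[rho_sqrt k]/((Num.sqrt (partition_fun^-1 * w k))%:C) fmorph_eq0 gt_eqF //.
by rewrite sqrtr_gt0 mulr_gt0 ?invr_gt0 ?partition_fun_gt0 ?expR_gt0.
Qed.

Lemma lowered_rho_sqrt_neq0 k : (lowered_rho_sqrt k != 0) = b k.
Proof.
rewrite -[lowered_rho_sqrt k]/(lowering_weight R l b k * rho_sqrt (k + l)%N).
rewrite mulf_eq0 (negPf (rho_sqrt_neq0 _)) orbF /lowering_weight mulf_eq0 negb_or.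
have -> : lower_coef R l k != 0.
  apply/eqP => E; have := lower_coef_ge1 R l k.
  by rewrite E Normc.normc0 ler10.
by case: (b k); rewrite ?oner_eq0 ?eqxx.
Qed.

End gibbs_state.

Lemma finite_set_nat_ub (A : set nat) : finite_set A ->
  exists K, forall k, A k -> (k < K)%N.
Proof.
move=> /finite_seqP[s ->]; exists (\max_(i <- s) i).+1 => k ks.
by rewrite ltnS; apply: (@leq_bigmax_seq _ _ xpredT id) ks isT.
Qed.

(** * Spectral projections of [N] and gaps in the Araki spectrum *)

Section spectral_data.
Variable R : realType.
Local Notation C := R[i].
Local Notation h := (l2 R).

Lemma indic_nat_set (E : set nat) k : \1_(nat_set E) (k%:R : R) = `[< E k >]%:R :> R.
Proof.
rewrite indicE; congr (_%:R); congr nat_of_bool; apply/idP/asboolP => [|Ek].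
  by rewrite inE => -[j Ej /eqP]; rewrite eqr_nat => /eqP <-.
by rewrite inE; exists k.
Qed.

Lemma spectral_projection_diag (E : set nat) :
  spectral_projection (nat_set E) = diag (fun k => `[< E k >]%:R : C).
Proof.
rewrite /spectral_projection fcalc_numop; congr diag; apply/funext => k.
by rewrite indic_nat_set rmorph_nat.
Qed.

Lemma measurable_nat_set (E : set nat) : measurable (nat_set E : set R).
Proof.
apply: countable_measurable => [t|]; first exact: measurable_set1.
exact: sub_countable (card_image_le _ _) (countableP _).
Qed.

Lemma numop_eigenvalue k : spectrum (@numop R) (k%:R)%:C.
Proof. by rewrite numop_diag; exact/eigenvalue_spectrum/diag_eigenvalue. Qed.

(** The resolvent bound, evaluated on the unit eigenvectors [fwd s (e_j)], gives a gap uniform in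
    [j]. Thus limit points of these eigenvalues are also kept out of the resolvent set, as the
    inclusion of spectra in (i) requires. *)
Lemma araki_resolvent_gap (beta : R) (g : R -> R) s (z : C) : 0 < beta ->
  resolvent_set (araki beta g) z -> exists2 delta : R, 0 < delta &
    forall j, delta <= normc ((beta * (g (j + s)%:R - g j%:R))%:C - z).
Proof.
move=> beta0 [_ [M LM]].
have gap j : 1 <= M * normc ((beta * (g (j + s)%:R - g j%:R))%:C - z).
  have /LM : araki beta g (fwd s (e_ R j), (beta * (g (j + s)%:R - g j%:R))%:C *: fwd s (e_ R j)).
    apply: araki_fwd => // k; rewrite coord_e; case: (eqVneq k j) => [->//|_].
    by rewrite eqxx.
  rewrite -scalerBl !fwdZ -[`|fwd _ (_ *: _)|]/((hsnorm _)%:C).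
  rewrite -[`|fwd _ _|]/((hsnorm _)%:C) !hsnorm_fwd l2normZr l2norm_e mulr1.
  by rewrite -rmorphM lecR.
have M0 : 0 < M.
  rewrite ltNge; apply/negP => M0; have := gap 0%N; rewrite leNgt => /negP; apply.
  by apply: le_lt_trans ltr01; rewrite mulr_le0_ge0 ?normc_ge0.
exists M^-1 => [|j]; first by rewrite invr_gt0.
by rewrite -[leLHS]mul1r ler_pdivrMr // mulrC gap.
Qed.

Lemma bump_eigenvalue (L : set (hs R * hs R)) (F : R -> C) (nu eps t : R) :
  fsupport F `<=` `[nu - eps, nu + eps] -> F nu = 1 ->
  (eps%:E < ereal_inf
     [set (Normc.normc (nu%:C - z))%:E | z in spectrum L `\ nu%:C])%E ->
  op_eigenvalue L t%:C -> F t = (t == nu)%:R.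
Proof.
move=> Fsupp Fnu gap /eigenvalue_spectrum Lt; have [->//|tnu] := eqVneq t nu.
apply: contraTeq gap => /= Ft; rewrite -leNgt.
have : t \in `[nu - eps, nu + eps] by apply: Fsupp; exact: subset_closure.
rewrite in_itv /= => tI.
apply: ge_ereal_inf; exists (normc (nu%:C - t%:C))%:E.
  by exists t%:C => //; split=> // /complexI /eqP; rewrite (negPf tnu).
by rewrite -rmorphB normc_realC lee_fin distrC ler_distl.
Qed.

End spectral_data.

Theorem proposition6p1 (R : realType) (g : R -> R) (beta : R) (m n : nat)
    (f : R -> R[i]) (eps : R)
    (l := (m - n)%N)
    (nu := beta * (g m%:R - g n%:R))
    (k := fun t : R => beta * (g (t + l%:R) - g t))
    (p := fun t : R => fourier f (k t))
    (L := araki beta g)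
    (N := @numop R)
    (Nl := op_pow N l)
    (pN := fcalc p N)
    (pNl := fcalc p (op_sub N (op_scale l%:R op_id)))
    (B := [set n' : nat | g m%:R - g n%:R = g (n' + l)%:R - g n'%:R])
    (Bl := [set (n' + l)%N | n' in B])
    (X := op_res (op_comp pN (op_pow annihilation l))
                 (op_dom (numpow (l%:R / 2))))
    (Xc := closure X)
    (P1 := op_comp (rising_numop l) pN)
    (P2 := op_comp (falling_numop l) pNl)
    (XXs := op_comp X (adjoint X))
    (XsX := op_comp (adjoint X) X) :
  (forall t, t <= 0 -> g t = 0) ->
  (forall s t, 0 <= s -> s < t -> g s < g t) ->
  0 < beta ->
  (n <= m)%N ->
  isolated_eigenvalue L nu%:C ->
  (\sum_(0 <= r <oo) (r%:R ^+ l * expR (- beta * g r%:R))%:E < +oo)%E ->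
  schwartz f ->
  test_function (fourier f) ->
  fsupport (fourier f) `<=` `[nu - eps, nu + eps] ->
  (forall s, nu - eps < s < nu + eps -> 0 < fourier f s) ->
  fourier f nu = 1 ->
  0 < eps ->
  (eps%:E < ereal_inf
     [set (Normc.normc (nu%:C - z))%:E | z in spectrum L `\ nu%:C])%E ->
  (* i *)
  (spectrum (fcalc (fun t => (k t)%:C) N) `<=` spectrum L /\
   isolated_eigenvalue (fcalc (fun t => (k t)%:C) N) nu%:C) /\
  (* ii *)
  [/\ measurable (nat_set B : set R),
      nat_set B `<=` [set r | spectrum N r%:C],
      pN = spectral_projection (nat_set B),
      op_comp pNl (spectral_projection (nat_set [set j | (l <= j)%N])) =
        spectral_projection (nat_set Bl) &
      (forall j, (j < l)%N -> g j%:R <> g m%:R - g n%:R) ->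
        pNl = spectral_projection (nat_set Bl)] /\
  (* iii *)
  ([/\ op_dom X = op_dom (numpow (l%:R / 2)),
       dense (op_dom X),
       closable X &
       finite_set (~` B) ->
         [/\ closed_op X, XsX = P2 & commutator_adj X = op_sub P1 P2]] /\
   [/\ XXs = P1,
       XsX = op_res P2 (op_dom X) &
       commutator_adj X = op_res (op_sub P1 P2) (op_dom X)] /\
   [/\ op_comp Xc (adjoint Xc) = P1,
       op_comp (adjoint Xc) Xc = P2 &
       commutator_adj Xc = op_sub P1 P2] /\
   (op_dom Nl `<=` op_dom XsX /\ op_dom Nl `<=` op_dom XXs)) /\
  (* iv *)
  ((forall M, exists2 n', B n' & (M < n')%N) -> (0 < l)%N ->
   [/\ ~ op_bounded (op_res XsX (op_dom Nl)),
       ~ op_bounded (op_res XXs (op_dom Nl)),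
       finite_set (~` B) ->
         discrete_spectrum (op_res XsX (op_dom Nl)) /\
         discrete_spectrum (op_res XXs (op_dom Nl)),
       discrete_spectrum_off_kernel (closure (op_res XsX (op_dom Nl))) &
       discrete_spectrum_off_kernel (closure (op_res XXs (op_dom Nl)))]) /\
  (* v *)
  (finite_set ((B `\` Bl) `|` (Bl `\` B)) ->
   infinitesimally_small (op_res (commutator_adj X) (op_dom Nl)) Nl) /\
  (* vi *)
  (exists xi0 xi : hs R,
    [/\ forall x, fcalc (fun t => (Num.sqrt t)%:C) (rho beta g) (x, xi0 x),
        left_op X (xi0, xi),
        xi != 0 &
        L (xi, nu%:C *: xi)]).
Proof.
move=> g0 gmono beta0 nm evL moment _ _ fsupp _ fnu1 eps0 gap.
pose b i := `[< B i >].
have mE : (n + l = m)%N by rewrite subnKC.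
have kE i : k i%:R = beta * (g (i + l)%:R - g i%:R) by rewrite natrD.
have fval t : op_eigenvalue L t%:C -> fourier f t = (t == nu)%:R.
  exact: bump_eigenvalue fsupp fnu1 gap.
have knu i : (k i%:R == nu) = b i.
  by rewrite kE (inj_eq (mulfI (lt0r_neq0 beta0))); apply/eqP/asboolP => /esym.
have pE i : p i%:R = (b i)%:R.
  rewrite /p fval ?knu // kE; exact: araki_eigenvalue.
have pNE : pN = diag (fun i => (b i)%:R) by rewrite /pN fcalc_numop; congr diag; apply/funext.
(* The entries of [pNl]; those below [l] are evaluated at negative arguments and need not vanish. *)
pose q i := p (i%:R - l%:R).
have pNlE : pNl = diag q.
  rewrite -[RHS](@fcalc_diag _ p (fun i => i%:R - l%:R)) /pNl /N numop_diag op_sub_diag.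
  congr fcalc; congr diag.
  by apply/funext => i; rewrite rmorphB !rmorph_nat.
have qE i : q (i + l)%N = (b i)%:R by rewrite /q natrD addrK.
have BlE i : `[< Bl i >] = (l <= i)%N && b (i - l)%N.
  apply/asboolP/andP => [[j Bj <-]|[li /asboolP Bi]].
    by rewrite leq_addl addnK; split=> //; exact/asboolP.
  by exists (i - l)%N => //; rewrite subnK.
have XE : X = @lowering R l b by rewrite /X pNE loweringE.
have XcE : Xc = wshift l (lowering_weight R l b) by rewrite /Xc XE closure_lowering.
have P1E : P1 = ndiag (raise_lower l b) by rewrite /P1 pNE rising_diag_proj.
have P2E : P2 = ndiag (lower_raise l b) by rewrite /P2 pNlE; exact: falling_diag_proj.
have XXsE : XXs = ndiag (raise_lower l b) by rewrite /XXs XE lowering_adjoint.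
have XsXE : XsX = op_res (ndiag (lower_raise l b)) (op_dom (numpow (l%:R / 2))).
  by rewrite /XsX XE adjoint_lowering_comp.
have domX : op_dom X = op_dom (numpow (l%:R / 2)) by rewrite XE dom_lowering.
have DlD : op_dom Nl `<=` op_dom (numpow (l%:R / 2)) by exact: pow_dom_half.
have cofin : finite_set (~` B) -> exists K, forall i, (K <= i)%N -> b i.
  move=> /finite_set_nat_ub[K BK]; exists K => i Ki; apply/asboolP; apply: contrapT => nBi.
  by have := BK i nBi; rewrite ltnNge Ki.
have XsXlE : op_res XsX (op_dom Nl) = op_res (ndiag (lower_raise l b)) (op_dom Nl).
  rewrite XsXE; apply/seteqP; split=> [p0 [[]]|p0 [? /[dup] ? /DlD]] //.
split; [|split; [|split; [|split; [|split]]]].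
- have kNE : fcalc (fun t => (k t)%:C) N = diag (fun i => (k i%:R)%:C).
    by rewrite /N fcalc_numop.
  rewrite kNE; have sub : spectrum (diag (fun i => (k i%:R)%:C)) `<=` spectrum L.
    move=> z sz rz; apply: sz; have [delta d0 dgap] := araki_resolvent_gap l beta0 rz.
    by apply: (diag_resolvent d0) => i; rewrite kE.
  split=> //; have knn : k n%:R = nu by rewrite kE mE.
  have ev : op_eigenvalue (diag (fun i => (k i%:R)%:C)) nu%:C.
    rewrite -knn; exact: (@diag_eigenvalue _ (fun i => (k i%:R)%:C)).
  split=> //; exact: isolated_sub sub (eigenvalue_spectrum ev) (proj2 evL).
- split.
  + exact: measurable_nat_set.
  + by move=> _ [i _ <-]; exact: numop_eigenvalue.
  + by rewrite pNE spectral_projection_diag.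
  + rewrite pNlE !spectral_projection_diag (@op_comp_diag _ _ _ 1) => [|i].
      congr diag; apply/funext => i; rewrite BlE asboolb.
      have [li|_] := leqP l i; last by rewrite mulr0.
      by rewrite mulr1 -qE subnK.
    rewrite mul1r -[leLHS]addr0 lerD ?normc_ge0 // normc_nat.
    by case: asboolP; rewrite ?ler01.
  + move=> gne; rewrite pNlE spectral_projection_diag; congr diag; apply/funext => i.
    rewrite BlE; have [li|il] := leqP l i; first by rewrite -qE subnK.
    (* As [g] vanishes at [i - l] and at 0, this is again an Araki eigenvalue, now for the shift [i]
       at index 0, so [fval] applies; the hypothesis keeps it away from [nu]. *)
    have kneg : k (i%:R - l%:R) = beta * (g (0 + i)%:R - g 0%:R).
      by rewrite /k subrK (g0 (_ - _)) ?(g0 0%:R) // subr_le0 ler_nat ltnW.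
    rewrite /q /p fval kneg; last exact: araki_eigenvalue.
    rewrite (inj_eq (mulfI (lt0r_neq0 beta0))) (g0 0%:R) // subr0 add0n.
    by have /eqP/negPf -> := gne _ il.
- split.
    split; first exact: domX.
    + by rewrite domX; apply: finsupp_dense => x; exact: finsupp_dom.
    + by rewrite /closable -/Xc XcE; exact: wshift_functional.
    move=> /cofin[K bK]; have Xshift := cofinite_lowering R l bK.
    have dom2 : op_dom (ndiag (lower_raise l b)) `<=` op_dom (numpow (l%:R / 2 : R)).
      by apply: subset_trans DlD; exact: cofinite_pow_dom_lower_raise bK.
    rewrite XsXE XE P1E P2E; split.
    + rewrite Xshift; split; first exact: wshift_functional.
      exact: closed_wshift.
    + exact: op_res_id.
    + by rewrite Xshift commutator_closure.
  split; first by rewrite XXsE XsXE P1E P2E domX XE commutator_lowering.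
  split; first by rewrite XcE P1E P2E adjoint_wshift wshift_bshift_lowering
    bshift_wshift_lowering commutator_closure.
  rewrite XXsE; split; last exact: pow_dom_raise_lower.
  move=> x xN; have [y xy] := pow_dom_lower_raise b xN.
  by exists y; rewrite XsXE; split=> //; exact: DlD.
- move=> Bunb l0; have finN := @finsupp_pow_dom R l.
  have big M : exists2 i, b i & (M < i)%N.
    by have [i Bi Mi] := Bunb M; exists i => //; exact/asboolP.
  rewrite XsXlE XXsE; split.
  + apply: ndiag_unbounded => // M; have [i bi Mi] := big M; exists (i + l)%N.
    by rewrite lower_raise_addn (ltn_trans Mi) // raise_lower_gt.
  + apply: ndiag_unbounded => // M; have [i bi Mi] := big M; exists i.
    by rewrite (ltn_trans Mi) // raise_lower_gt.
  + move=> /cofin[K bK]; rewrite !op_res_id.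
    * split; apply: ndiag_discrete => v.
        exact: cofinite_lower_raise_tends bK.
      exact: cofinite_raise_lower_tends bK.
    * exact: cofinite_pow_dom_raise_lower bK.
    * exact: cofinite_pow_dom_lower_raise bK.
  + rewrite closure_ndiag_res //; apply: ndiag_discrete_off_kernel => v.
    exact: lower_raise_tends.
  + rewrite closure_ndiag_res //; apply: ndiag_discrete_off_kernel => v.
    exact: raise_lower_tends.
- move=> /finite_set_nat_ub[K BK]; rewrite XE.
  (* Above [l] the difference [i - l] is not truncated, so membership of [i] in [B + l] means
     membership of [i - l] in [B]. *)
  apply: (@commutator_small _ _ _ (maxn K l)); last exact: leq_maxr.
  move=> i; rewrite geq_max => /andP[Ki li]; have := BlE i; rewrite li /= => <-.
  apply/asboolP/asboolP => Bi; apply: contrapT => nBi.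
    by have := BK i (or_introl (conj Bi nBi)); rewrite ltnNge Ki.
  by have := BK i (or_intror (conj Bi nBi)); rewrite ltnNge Ki.
- exists (fwd 0 (rho_sqrt moment)), (fwd l (lowered_rho_sqrt b moment)); split.
  + exact: rho_sqrt_fwd.
  + by rewrite XE; exact: lowering_rho_sqrt.
  (* The weight at [n] is nonzero because [n + l = m] puts [n] in [B]. *)
  + apply: (@fwd_neq0 _ _ _ n); rewrite lowered_rho_sqrt_neq0 -knu kE mE.
    exact: eqxx.
  + apply: araki_fwd => // i; rewrite lowered_rho_sqrt_neq0 -knu kE.
    by move/eqP.
Qed.
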